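(* Let $X$, $A$, $B$, $C$ be as in the context and let $W_1$ denote $D(A^{1/2})$ equipped with the norm $\|\xi\|_{A^{1/2}}:=\|A^{1/2}\xi\|$. Let $t_0\in\mathbb{R}$, $\xi\in D(A)$ and $\eta\in D(A^{1/2})$. Then there is a uniquely determined differentiable map $u:\mathbb{R}\to W_1$ with $u(t_0)=\xi$ and $u'(t_0)=\eta$ such that $u':\mathbb{R}\to X$ is differentiable with $(u')'(t)+iBu'(t)+(A+C)u(t)=0$ for all $t\in\mathbb{R}$.
   Context: $(X,\langle\cdot|\cdot\rangle)$ is a nontrivial complex Hilbert space with norm $\|\cdot\|$. $A:D(A)\to X$ is a densely defined self-adjoint linear operator with $\langle\xi|A\xi\rangle\geqslant\varepsilon\langle\xi|\xi\rangle$ for all $\xi\in D(A)$ for some $\varepsilon>0$; $A^{1/2}$ is its positive self-adjoint square root. $B:D(A^{1/2})\to X$ is linear with $\|B\xi\|^2\leqslant a^2\|A^{1/2}\xi\|^2+b^2\|\xi\|^2$ for all $\xi\in D(A^{1/2})$, for some $a\in[0,1)$, $b\in\mathbb{R}$, and $B$ is symmetric or bounded. $C:D(A^{1/2})\to X$ is linear with $\|C\xi\|^2\leqslant c^2\|A^{1/2}\xi\|^2+d^2\|\xi\|^2$ for all $\xi\in D(A^{1/2})$, for some real $c,d$. *)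

(* Defs.v *)
From HB Require Import structures.
From mathcomp Require Import all_boot all_order all_algebra.
From mathcomp Require Import reals.
From mathcomp Require Import complex.

Set Implicit Arguments.
Unset Strict Implicit.
Unset Printing Implicit Defensive.
Import Order.TTheory GRing.Theory Num.Theory.
Local Open Scope ring_scope.

Section Hilbert.
Variable R : realType.
Variable X : lmodType R[i].
(* inner product, conjugate-linear in the first and linear in the second
   argument (bra-ket convention <xi|A xi>) *)
Variable ip : X -> X -> R[i].

Definition is_inner_product : Prop :=
  [/\ (forall x y : X, ip x y = conjc (ip y x)),
      (forall (a : R[i]) (x y z : X), ip x (a *: y + z) = a * ip x y + ip x z),
      (forall x : X, 0 <= ip x x) &
      (forall x : X, ip x x = 0 -> x = 0)].

Definition hnorm (x : X) : R := Num.sqrt (complex.Re (ip x x)).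

Definition hcomplete : Prop :=
  forall u : nat -> X,
    (forall e : R, 0 < e -> exists N : nat,
        forall m n : nat, (N <= m)%N -> (N <= n)%N -> hnorm (u m - u n) < e) ->
    exists l : X, forall e : R, 0 < e -> exists N : nat,
        forall n : nat, (N <= n)%N -> hnorm (u n - l) < e.

Definition is_hilbert : Prop := is_inner_product /\ hcomplete.

(* operators: a domain D (a predicate on X) and a map T (values outside D
   are irrelevant) *)
Definition subspace (D : X -> Prop) : Prop :=
  D 0 /\ forall (a : R[i]) (x y : X), D x -> D y -> D (a *: x + y).

Definition linear_on (D : X -> Prop) (T : X -> X) : Prop :=
  forall (a : R[i]) (x y : X), D x -> D y -> T (a *: x + y) = a *: T x + T y.

Definition densely_defined (D : X -> Prop) : Prop :=
  forall (x : X) (e : R), 0 < e -> exists y : X, D y /\ hnorm (x - y) < e.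

(* (D,T) is a densely defined linear operator equal to its adjoint:
   y is in the domain of the adjoint T^* with T^* y = z  iff  y in D and z = T y. *)
Definition self_adjoint (D : X -> Prop) (T : X -> X) : Prop :=
  [/\ subspace D, linear_on D T, densely_defined D &
      forall y z : X,
        (forall x : X, D x -> ip (T x) y = ip x z) <-> (D y /\ z = T y)].

Definition is_pos_sqrt (DA : X -> Prop) (A : X -> X)
  (DS : X -> Prop) (S : X -> X) : Prop :=
  [/\ self_adjoint DS S,
      (forall x : X, DS x -> 0 <= ip x (S x)),
      (forall x : X, DA x <-> (DS x /\ DS (S x))) &
      (forall x : X, DA x -> S (S x) = A x)].

Definition has_deriv_N (N : X -> R) (u : R -> X) (t : R) (v : X) : Prop :=
  forall e : R, 0 < e -> exists d : R, 0 < d /\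
    forall h : R, h != 0 -> `|h| < d ->
      N ((h^-1)%:C%C *: (u (t + h) - u t) - v) <= e.

Definition is_solution (DA : X -> Prop) (A : X -> X) (DS : X -> Prop)
  (S : X -> X) (B C : X -> X) (t0 : R) (xi eta : X) (u : R -> X) : Prop :=
  (forall t : R, DS (u t)) /\
  exists u' u'' : R -> X,
  [/\ (forall t : R, DS (u' t) /\ has_deriv_N (fun x => hnorm (S x)) u t (u' t)),
      (forall t : R, has_deriv_N hnorm u' t (u'' t)),
      u t0 = xi, u' t0 = eta &
      (forall t : R, DA (u t) /\
         u'' t + 'i%C *: B (u' t) + (A (u t) + C (u t)) = 0)].

End Hilbert.

(* Main.v *)
Require Import Defs.
From HB Require Import structures.
From mathcomp Require Import all_boot all_order all_algebra.
From mathcomp Require Import ring lra interval_inference.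
From mathcomp Require Import all_classical reals.
From mathcomp Require Import topology normedtype sequences realfun exp.
From mathcomp Require Import complex.

(** With [S = A^(1/2)], [p = S u] and [q = u'] the equation becomes the
    first-order system [(p, q)' = G (p, q)] on [X * X], where
    [G (p, q) = (S q, - S p - i B q - C S^-1 p)] has domain [D(S) * D(S)].
    The map [(p, q) |-> (S q, - S p)] is skew-adjoint, the real part of
    [<q | i B q>] is bounded by a multiple of [|q|^2] and [C S^-1] is bounded,
    so [|x - h G x| >= (1 - w |h|) |x|] for every real [h]; since [a < 1],
    [1 - h G] is a contractive perturbation of an onto map, hence onto for small
    [h <> 0].  Let [J h] be the inverse of [1 - h G].  On [D(G^2)],
    [J a (J b x) - J (a + b) x = - a b J a (J b (J (a + b) (G (G x))))],
    so telescoping shows that [J (t / 2^k) ^ (2^k)] converges to a group [T t]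
    with [(T t x)' = T t (G x)] for [x] in [D(G)].  Solutions [v] are unique
    because [s |-> T (t - s) (v s)] has zero derivative. *)

Set Implicit Arguments.
Unset Strict Implicit.
Unset Printing Implicit Defensive.
Import Order.TTheory GRing.Theory Num.Theory.
Import numFieldNormedType.Exports.
Local Open Scope classical_set_scope.
Local Open Scope ring_scope.

(** * Groups generated by operators on Banach spaces *)

Section Banach.
Variables (R : realType) (V : completeNormedModType R).
Implicit Types (x y z : V) (u : nat -> V).

(** The coordinate [p = S u] turns the norm of [W_1] into that of [X]: differentiability of [u] into
    [W_1] becomes differentiability of [p] into [X], and [u] in [D(A)] becomes [p] in [D(S)]. The
    condition [a < 1] enters as follows. If [(p, q)] solves the resolvent equation of the skew part
    with right-hand side [z], then [|h| |S q| <= |z|], so [h B q] costs at most [a |z|] plus a term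
    that vanishes with [h]. Only real [h] occur, so [X * X] is used as a real Banach space and the
    real part of the inner product suffices. Step numbers are powers of two because passing from
    [2^k] to [2^(k+1)] steps costs [O(2^-k)], which is summable. *)

Lemma cvg_of_cauchy_tail u :
  (forall e : R, 0 < e -> exists N : nat,
     forall n : nat, (N <= n)%N -> `|u n - u N| <= e) -> cvgn u.
Proof.
move=> uC; apply: cauchy_cvg; apply: cauchy_exP => e e0.
have [|N HN] := uC (e / 2); first by lra.
exists (u N); exists N => // n /= Nn; rewrite -ball_normE /= distrC.
by apply: le_lt_trans (HN _ Nn) _; lra.
Qed.

Lemma norm_cvg_le u l (c : R) :
  u @ \oo --> l -> (\forall n \near \oo, `|u n| <= c) -> `|l| <= c.
Proof.
move=> ul uc; have nl : (fun n => `|u n|) @ \oo --> `|l| by exact: cvg_norm.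
by rewrite -(cvg_lim _ nl)//; apply: limr_le => //; exact: (cvgP _ nl).
Qed.

(** The division-free form survives bounded linear maps and sums directly; at [h = 0] both sides
    vanish. *)
Definition has_derivative (u : R -> V) (t : R) (v : V) :=
  forall e : R, 0 < e -> exists2 d : R, 0 < d &
    forall h : R, `|h| < d -> `|u (t + h) - u t - h *: v| <= e * `|h|.

(** Reduction to real functions: by the reverse triangle inequality [r |-> |g r - g t|] also has
    zero derivative, so it keeps the value [0] that it takes at [t]. *)
Lemma has_derivative0_cst (g : R -> V) :
  (forall s, has_derivative g s 0) -> forall s t, g s = g t.
Proof.
move=> g0 s t; apply/eqP; rewrite -subr_eq0 -normr_eq0; apply/eqP.
pose f r := `|g r - g t| : R.
rewrite -/(f s) (_ : 0 = f t); last by rewrite /f subrr normr0.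
apply: is_derive_0_is_cst => {}s.
suff cf : (fun h => h^-1 *: ((f \o shift s) (h *: 1) - f s)) @ 0^' --> (0 : R).
  by split; [exact: cvgP cf|exact: cvg_lim cf].
apply/cvgrPdist_le => e e0; have [d d0 gd] := g0 s e e0.
exists d => //= h; rewrite /= sub0r normrN => hd h0.
rewrite sub0r normrN normrZ normfV mulrC ler_pdivrMr ?normr_gt0//.
have -> : h *: (1:R) = h by rewrite /GRing.scale/= mulr1.
have /= := gd h hd; rewrite scaler0 subr0 addrC; apply: le_trans.
rewrite /f; apply: le_trans (ler_dist_dist _ _) _.
by rewrite opprB addrA subrK (addrC h) (addrC (- g s)).
Qed.

Lemma cvg_bounded_additive (L : V -> V) (K : R) u l :
  (forall x y, L (x - y) = L x - L y) -> (forall x, `|L x| <= K * `|x|) ->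
  u @ \oo --> l -> L \o u @ \oo --> L l.
Proof.
move=> La Lb /cvgrPdist_le ul; apply/cvgrPdist_le => e e0.
have K0 : 0 < `|K| + 1 by rewrite ltr_wpDl.
have := ul (e / (`|K| + 1)) (divr_gt0 e0 K0); apply: filterS => n /= un.
rewrite -La; apply: le_trans (Lb _) _.
rewrite ler_pdivlMr// mulrC in un; apply: le_trans un.
by apply: ler_wpM2r => //; rewrite (le_trans (ler_norm _))// lerDl.
Qed.

(* Telescoping [P^n - Q^n = \sum_k P^(n-1-k) (P - Q) Q^k]. *)
Lemma iter_dist (P Q : V -> V) (p : R) n x :
  1 <= p ->
  (forall x y, P (x - y) = P x - P y) -> (forall x y, Q (x - y) = Q x - Q y) ->
  (forall x, `|P x| <= p * `|x|) -> (forall x, `|Q x| <= p * `|x|) ->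
  (forall x, P (Q x) = Q (P x)) ->
  `|iter n P x - iter n Q x| <= n%:R * p ^+ n * `|P x - Q x|.
Proof.
move=> p1 Pa Qa Pb Qb PQ; have p0 : 0 <= p by lra.
have Qn m y : `|iter m Q y| <= p ^+ m * `|y|.
  elim: m => [|m IH] /=; first by rewrite expr0 mul1r.
  by rewrite exprS -mulrA (le_trans (Qb _))// ler_wpM2l.
have Qd m y z : iter m Q (y - z) = iter m Q y - iter m Q z.
  by elim: m => //= m ->.
have PQn m y : P (iter m Q y) = iter m Q (P y).
  by elim: m => //= m <-.
have QQn m y : Q (iter m Q y) = iter m Q (Q y) by rewrite -iterS iterSr.
elim: n => [|n IH]; first by rewrite /= subrr normr0 !mul0r.
have -> : iter n.+1 P x - iter n.+1 Q x =
  P (iter n P x - iter n Q x) + iter n Q (P x - Q x).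
  by rewrite /= Qd -PQn -QQn Pa addrA subrK.
apply: le_trans (ler_normD _ _) _.
apply: le_trans (lerD (le_trans (Pb _) (ler_wpM2l p0 IH)) (Qn _ _)) _.
set d := `|_|; have d0 : 0 <= d by exact: normr_ge0.
have pn : p ^+ n <= p ^+ n.+1 by rewrite exprS ler_peMl ?exprn_ge0.
have := ler_wpM2r d0 pn.
rewrite -natr1 !mulrDl mul1r !mulrA (mulrC p) -!mulrA (mulrA p) -exprS !mulrA.
lra.
Qed.
End Banach.

Lemma neumann_surj (R : realType) (V : completeNormedModType R) (L : V -> V)
    (k : R) : 0 <= k < 1 ->
  (forall x y, L (x - y) = L x - L y) -> (forall x, `|L x| <= k * `|x|) ->
  forall y, exists x, x - L x = y.
Proof.
move=> /andP[k0 k1] LB Lk y.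
pose f : {fun [set: V] >-> [set: V]} := totalfun (fun x => y + L x).
have [] := @banach_fixed_point R V setT f.
- exists (NngNum k0); split => //= -[x z] _ /=.
  by rewrite opprD addrACA subrr add0r -LB.
- exact: closedT.
- by exists 0.
- by move=> x _ xE; exists x; rewrite {1}xE /= addrK.
Qed.

(** * Resolvents of the generator and their products *)

Section Generator.
Variables (R : realType) (V : completeNormedModType R).
Variables (D : set V) (G : V -> V) (w h0 : R).
Hypothesis D_sub : forall (a : R) x y, D x -> D y -> D (a *: x + y).
Hypothesis G_lin :
  forall (a : R) x y, D x -> D y -> G (a *: x + y) = a *: G x + G y.
Hypothesis D_dense : forall x (e : R), 0 < e -> exists2 y, D y & `|x - y| < e.
Hypotheses (w_ge0 : 0 <= w) (h0_gt0 : 0 < h0) (wh0 : w * h0 <= 1 / 2).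
Hypothesis G_low :
  forall (h : R) x, D x -> (1 - w * `|h|) * `|x| <= `|x - h *: G x|.
Hypothesis G_surj :
  forall (h : R) y, 0 < `|h| < h0 -> exists2 x, D x & x - h *: G x = y.
Implicit Types (x y z : V) (a b h s t : R) (k n : nat).

Lemma dom_subr h x y : D x -> D y -> D (x - h *: y).
Proof. by move=> Dx Dy; rewrite addrC -scaleNr; exact: D_sub. Qed.

Lemma dom_scale a x : D x -> D (a *: x).
Proof.
move=> Dx; have D0 : D 0 by rewrite -(addNr x) -scaleN1r; exact: D_sub.
by rewrite -[_ *: _]addr0; exact: D_sub.
Qed.

Lemma gen_subr h x y : D x -> D y -> G (x - h *: y) = G x - h *: G y.
Proof. by move=> Dx Dy; rewrite addrC -scaleNr G_lin// scaleNr addrC. Qed.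

(* The resolvent [(1 - h G)^-1], extended by the identity to the other [h] so
   that linearity, commutation and the norm bound hold for every [h]. *)
Definition resolvent h y : V :=
  if 0 < `|h| < h0 then xget 0 [set x | D x /\ x - h *: G x = y] else y.
Local Notation J := resolvent.

Lemma resolventP h y :
  0 < `|h| < h0 -> D (J h y) /\ J h y - h *: G (J h y) = y.
Proof.
move=> hh; rewrite /J hh.
have [x Dx xy] := G_surj y hh.
have := @xgetPex _ 0 [set x | D x /\ x - h *: G x = y].
by apply; exists x.
Qed.

Lemma small_step h : `|h| < h0 -> w * `|h| <= 1 / 2.
Proof. by move=> hh; apply: le_trans wh0; rewrite ler_wpM2l// ltW. Qed.

Lemma one_sub_inj h x y : `|h| < h0 -> D x -> D y ->
  x - h *: G x = y - h *: G y -> x = y.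
Proof.
move=> hh Dx Dy e; have := G_low h (D_sub (-1) Dy Dx).
rewrite G_lin// !scaleN1r.
have -> : - y + x - h *: (- G y + G x) = x - h *: G x - (y - h *: G y).
  by rewrite scalerDr scalerN !opprD !opprK addrACA addrC.
rewrite e subrr.
rewrite normr0 => le0; have w1 := small_step hh.
have := normr_ge0 (- y + x) => n0.
have : `|- y + x| = 0 by nra.
by move/normr0_eq0/eqP; rewrite addrC subr_eq0 => /eqP.
Qed.

Lemma resolvent_id x : J 0 x = x.
Proof. by rewrite /J normr0 ltxx. Qed.

Lemma resolvent_domP h x :
  `|h| < h0 -> D x -> D (J h x) /\ J h x - h *: G (J h x) = x.
Proof.
move=> hh Dx; have [->|hn0] := eqVneq h 0.
  by rewrite resolvent_id scale0r subr0.
by apply: resolventP; rewrite normr_gt0 hn0.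
Qed.

(** Identities between resolvents are proved through this uniqueness, by exhibiting a solution in
    [D]. *)
Lemma resolvent_eq h x y : `|h| < h0 -> D x -> x - h *: G x = y -> J h y = x.
Proof.
move=> hh Dx xy; have [hE|hn0] := eqVneq h 0.
  by rewrite -xy hE resolvent_id scale0r subr0.
have [|DJ Jy] := @resolventP h y; first by rewrite normr_gt0 hn0.
by apply: (one_sub_inj hh) => //; rewrite Jy.
Qed.

Lemma resolventD h a x y : J h (a *: x + y) = a *: J h x + J h y.
Proof.
have [hh|hh] := boolP (0 < `|h| < h0); last by rewrite /J (negbTE hh).
have [Dx Jx] := resolventP x hh; have [Dy Jy] := resolventP y hh.
have /andP[_ hlt] := hh; apply: resolvent_eq => //; first exact: D_sub.
rewrite G_lin// -[in RHS]Jx -[in RHS]Jy scalerBr scalerDr !scalerA (mulrC a).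
by rewrite opprD addrACA.
Qed.

Lemma resolventB h x y : J h (x - y) = J h x - J h y.
Proof. by rewrite addrC -scaleN1r resolventD scaleN1r addrC. Qed.

Lemma resolvent0 h : J h 0 = 0.
Proof. by rewrite -[in LHS](subrr 0) resolventB subrr. Qed.

Lemma resolventZ h a x : J h (a *: x) = a *: J h x.
Proof. by rewrite -[a *: x]addr0 resolventD resolvent0 addr0. Qed.

Lemma resolvent_low h x : 0 < `|h| < h0 -> (1 - w * `|h|) * `|J h x| <= `|x|.
Proof.
move=> hh; have [DJ JE] := resolventP x hh.
by have := G_low h DJ; rewrite JE.
Qed.

(** For [0 <= s <= 1/2] one has [(1 + 2 s) (1 - s) >= 1] and [1 + 2 s <= exp (2 s)]. The exponential
    makes the bound for [n] iterates depend on [n |h|] alone. *)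
Lemma resolvent_norm h x : `|J h x| <= expR (2 * w * `|h|) * `|x|.
Proof.
have e1 := expR_ge1Dx (2 * w * `|h|).
have wh : 0 <= w * `|h| by rewrite mulr_ge0.
have x0 := normr_ge0 x.
have [hh|hh] := boolP (0 < `|h| < h0); last first.
  rewrite /J (negbTE hh) ler_peMl//; lra.
have /andP[_ /small_step w1] := hh; have := resolvent_low x hh => lo.
have J0 := normr_ge0 (J h x).
apply: (@le_trans _ _ ((1 + 2 * w * `|h|) * `|x|)); last by rewrite ler_wpM2r.
move: e1 lo w1 wh; set s := w * `|h|; rewrite -!mulrA -/s => e1 lo w1 wh.
have := ler_wpM2l (_ : 0 <= 1 + 2 * s) lo; move=> /(_ ltac:(lra)).
apply: le_trans; rewrite mulrA ler_peMl//; nra.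
Qed.

Lemma resolvent_norm2 h x : `|J h x| <= 2 * `|x|.
Proof.
have x0 := normr_ge0 x; have J0 := normr_ge0 (J h x).
have [hh|hh] := boolP (0 < `|h| < h0); last by rewrite /J (negbTE hh); lra.
have /andP[_ /small_step w1] := hh; have := resolvent_low x hh; nra.
Qed.

(** For [x] in [D] the resolvent equation itself puts [G (J h x)] into [D], so [G] may be applied to
    that equation. *)
Lemma G_resolvent h x : `|h| < h0 -> D x -> G (J h x) = J h (G x).
Proof.
move=> hh Dx; have [->|hn0] := eqVneq h 0; first by rewrite !resolvent_id.
have [DJ JE] := resolvent_domP hh Dx; apply/esym.
have GE : G (J h x) = h^-1 *: (J h x - x).
  by rewrite -{3}JE opprB addrC subrK scalerA mulVf// scale1r.
have DG : D (G (J h x)).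
  by rewrite GE; apply: dom_scale; have := dom_subr 1 DJ Dx; rewrite scale1r.
by apply: resolvent_eq => //; rewrite -gen_subr// JE.
Qed.

Lemma resolvent_comm a b x : J a (J b x) = J b (J a x).
Proof.
have [ha|ha] := boolP (0 < `|a| < h0); last by rewrite /J (negbTE ha).
have [hb|hb] := boolP (0 < `|b| < h0); last by rewrite /J (negbTE hb).
have [DJ JE] := resolventP x hb; have [DJJ JJE] := resolventP (J b x) ha.
have /andP[_ alt] := ha; have /andP[_ blt] := hb.
(* With [z = J a (J b x)] the two uses reduce the claim to [(1 - a G) ((1 - b G) z) = x], where
   [(1 - b G) z = J a x]. *)
apply/esym/resolvent_eq => //; apply/esym/resolvent_eq => //.
  rewrite G_resolvent//; apply: dom_subr => //.
  by have [] := resolventP (G (J b x)) ha.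
rewrite G_resolvent// -resolventZ -resolventB JE.
by have [_ ->] := resolventP x ha.
Qed.

Lemma resolvent_sub h x : `|h| < h0 -> D x -> J h x - x = h *: J h (G x).
Proof.
move=> hh Dx; rewrite -G_resolvent//; have [_] := resolvent_domP hh Dx.
by move=> JE; rewrite -{2}JE opprB addrC subrK.
Qed.

(** Since [(1 - b G) (1 - a G) = 1 - (a + b) G + a b G^2], the vector [z = J (a + b) x] equals
    [J a (J b (x + a b G (G z)))]. The factor [8] bounds three resolvents of norm at most [2]. *)
Lemma resolvent_mul_dist a b x :
  `|a| < h0 -> `|b| < h0 -> `|a + b| < h0 -> D x -> D (G x) ->
  `|J a (J b x) - J (a + b) x| <= 8 * `|a * b| * `|G (G x)|.
Proof.
move=> ha hb hab Dx DGx; pose z := J (a + b) x.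
have [Dz zE] := resolvent_domP hab Dx; rewrite -/z in Dz zE.
have Gz : G z = J (a + b) (G x) by rewrite G_resolvent.
have DGz : D (G z) by rewrite Gz; have [] := resolvent_domP hab DGx.
have GGz : G (G z) = J (a + b) (G (G x)) by rewrite Gz G_resolvent.
have zJ : J a (J b (x + (a * b) *: G (G z))) = z.
  rewrite (@resolvent_eq b (z - a *: G z))//.
  - exact: resolvent_eq.
  - exact: dom_subr.
  rewrite gen_subr// -[in RHS]zE scalerBr scalerA (mulrC b) scalerDl !opprD
    opprK.
  by rewrite !addrA.
have -> : J a (J b x) - z = - (a * b) *: J a (J b (G (G z))).
  by rewrite -{1}zJ addrC [x + _]addrC !resolventD opprD subrK scaleNr.
rewrite normrZ normrN mulrAC mulrC ler_wpM2r// GGz.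
have := resolvent_norm2 a (J b (J (a + b) (G (G x)))).
have := resolvent_norm2 b (J (a + b) (G (G x))).
have := resolvent_norm2 (a + b) (G (G x)).
lra.
Qed.

Lemma resolvent_iter_norm n h x :
  `|iter n (J h) x| <= expR (2 * w * (n%:R * `|h|)) * `|x|.
Proof.
elim: n => [|n IH] /=; first by rewrite mul0r mulr0 expR0 mul1r.
rewrite (le_trans (resolvent_norm _ _))//.
rewrite -(natr1 n) (mulrDl n%:R) mul1r (mulrDr (2 * w)) addrC expRD.
by rewrite -[leRHS]mulrA ler_wpM2l ?expR_ge0.
Qed.

Lemma resolvent_iterD n h a x y :
  iter n (J h) (a *: x + y) = a *: iter n (J h) x + iter n (J h) y.
Proof. by elim: n => //= n ->; rewrite resolventD. Qed.

Lemma resolvent_iter_comm n h a x : iter n (J h) (J a x) = J a (iter n (J h) x).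
Proof. by elim: n => //= n ->; rewrite resolvent_comm. Qed.

Lemma iter_resolvent_mul n a b x :
  iter n (fun x => J a (J b x)) x = iter n (J a) (iter n (J b) x).
Proof.
by elim: n => //= n ->; rewrite resolvent_iter_comm.
Qed.

Lemma small_quotient n t : (0 < n)%N -> `|t| < n%:R * h0 -> `|t / n%:R| < h0.
Proof.
move=> n0 tn; rewrite normrM normfV (ger0_norm (ler0n _ _)).
by rewrite ltr_pdivrMr ?ltr0n// mulrC.
Qed.

(** Each of the [n] telescoped terms is of order [(s / n) (t / n)], so the total is of order
    [1 / n]. Taken at [t / 2] twice this compares consecutive dyadic approximants; for general [s],
    [t] it gives the group law in the limit. *)
Lemma resolvent_iter_group n s t x : (0 < n)%N -> `|s| + `|t| < n%:R * h0 ->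
  D x -> D (G x) ->
  `|iter n (J (s / n%:R)) (iter n (J (t / n%:R)) x)
    - iter n (J ((s + t) / n%:R)) x|
  <= expR (2 * w * (`|s| + `|t|)) * (8 * `|s * t| * `|G (G x)|) / n%:R.
Proof.
move=> n0 st Dx DGx; set a := s / _; set b := t / _.
have nR : 0 < n%:R :> R by rewrite ltr0n.
have -> : (s + t) / n%:R = a + b by rewrite mulrDl.
have s0 := normr_ge0 s; have t0 := normr_ge0 t.
have ha : `|a| < h0 by apply: small_quotient => //; lra.
have hb : `|b| < h0 by apply: small_quotient => //; lra.
have hab : `|a + b| < h0.
  by rewrite -mulrDl; apply: small_quotient => //;
    apply: le_lt_trans (ler_normD _ _) st.
have na (c : R) : n%:R * `|c / n%:R| = `|c|.
  by rewrite normrM normfV (ger0_norm (ltW nR)) mulrCA mulfV ?mulr1// gt_eqF.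
pose p := expR (2 * w * (`|a| + `|b|)).
have w2 : 0 <= 2 * w by rewrite mulr_ge0.
have p1 : 1 <= p.
  by rewrite -expR0 ler_expR mulr_ge0// addr_ge0.
have pn : p ^+ n = expR (2 * w * (`|s| + `|t|)).
  by rewrite -expRM_natl mulrCA mulrDr !na.
rewrite -iter_resolvent_mul.
apply: le_trans (iter_dist n x p1 _ _ _ _ _) _.
- by move=> y z; rewrite !resolventB.
- by move=> y z; rewrite resolventB.
- move=> y; apply: le_trans (resolvent_norm _ _) _.
  rewrite /p mulrDr expRD -[leRHS]mulrA ler_wpM2l ?expR_ge0//.
  exact: resolvent_norm.
- move=> y; apply: le_trans (resolvent_norm _ _) _.
  by rewrite ler_wpM2r// ler_expR ler_wpM2l// ler_normD.
- by move=> y; rewrite [J b (J (a + b) _)]resolvent_comm resolvent_comm.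
rewrite pn -[leRHS]mulrA [_ * expR _]mulrC -[leLHS]mulrA ler_wpM2l ?expR_ge0//.
have := ler_wpM2l (ltW nR) (resolvent_mul_dist ha hb hab Dx DGx).
move=> /le_trans; apply; rewrite /a /b mulrACA normrM -invfM normfV.
rewrite (@ger0_norm _ (n%:R * _)) ?mulr_ge0// le_eqVlt; apply/orP; left;
  apply/eqP.
by field; rewrite gt_eqF.
Qed.

(** Resolvents smooth: for [y] in [D], [J h y] lies in [D(G^2)] and differs from [y] by
    [h J h (G y)]. *)
Lemma dom_square_dense x (e : R) : 0 < e -> exists2 y, D y /\ D (G y) & `|x -
  y| < e.
Proof.
move=> e0; have [|y Dy xy] := D_dense x (_ : 0 < e / 2); first by lra.
pose h := Num.min (h0 / 2) (e / (8 * (`|G y| + 1))).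
have Gy0 := normr_ge0 (G y).
have h_gt0 : 0 < h by rewrite lt_min !divr_gt0//; lra.
have hh : `|h| < h0.
  have hm : h <= h0 / 2 by rewrite /h ge_min lexx.
  by rewrite gtr0_norm//; lra.
have he : h * (`|G y| + 1) <= e / 8.
  rewrite -ler_pdivlMr ?ltr_wpDl// -mulrA -invfM.
  by rewrite /h ge_min lexx orbT.
exists (J h y).
  have hh' : 0 < `|h| < h0 by rewrite hh normr_gt0 gt_eqF.
  split; first by have [] := resolventP y hh'.
  by rewrite G_resolvent//; have [] := resolventP (G y) hh'.
have := resolvent_sub hh Dy => JE.
have n2 := resolvent_norm2 h (G y).
have nJ : `|J h y - y| <= h * (2 * `|G y|).
  by rewrite JE normrZ gtr0_norm// ler_wpM2l// ltW.
have := ler_distD y x (J h y); rewrite [`|y - J h y|]distrC.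
lra.
Qed.

(** For small [k] the step may be too large for the resolvent, and [J] is then the identity; the
    norm bound holds for all [k] regardless. *)
Definition approx k t x : V := iter (2 ^ k) (J (t / (2 ^ k)%:R)) x.
Definition growth t : R := expR (2 * w * `|t|).

Lemma approx_norm k t x : `|approx k t x| <= growth t * `|x|.
Proof.
apply: le_trans (resolvent_iter_norm _ _ _) _.
rewrite normrM normfV (ger0_norm (ler0n _ _)) [(2 ^ k)%:R * _]mulrC.
by rewrite divfK ?pnatr_eq0 ?expn_eq0.
Qed.

Lemma approxD k t a x y :
  approx k t (a *: x + y) = a *: approx k t x + approx k t y.
Proof. exact: resolvent_iterD. Qed.

Lemma approxB k t x y : approx k t (x - y) = approx k t x - approx k t y.
Proof. by rewrite addrC -scaleN1r approxD scaleN1r addrC. Qed.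

Lemma pow2_unbounded (r : R) : exists K, forall k, (K <= k)%N -> r < (2 ^ k)%:R.
Proof.
have := archi_boundP (normr_ge0 r); set K := Num.bound _ => rK.
exists K => k Kk; apply: le_lt_trans (ler_norm r) _; apply: lt_trans rK _.
by rewrite ltr_nat; apply: leq_ltn_trans Kk _; exact: ltn_expl.
Qed.

Lemma approx_step k t x : `|t| < (2 ^ k)%:R * h0 -> D x -> D (G x) ->
  `|approx k.+1 t x - approx k t x|
    <= growth t * (2 * t ^+ 2 * `|G (G x)|) / (2 ^ k)%:R.
Proof.
move=> tk Dx DGx.
have := @resolvent_iter_group (2 ^ k) (t / 2) (t / 2) x _ _ Dx DGx.
have -> : t / 2 + t / 2 = t by lra.
have -> : `|t / 2| + `|t / 2| = `|t|.
  by rewrite normrM (@ger0_norm _ 2^-1) ?invr_ge0//; lra.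
rewrite -iterD addnn -mul2n -expnS -mulrA -invfM -natrM -expnS.
rewrite -/(approx _ _ _) -/(approx _ _ _) -/(growth t).
rewrite (ger0_norm (_ : 0 <= t / 2 * (t / 2))) ?sqr_ge0//.
rewrite (_ : 8 * (t / 2 * (t / 2)) = 2 * t ^+ 2); last by field.
by apply => //; rewrite expn_gt0.
Qed.

Lemma pow2_gt0 k : 0 < (2 ^ k)%:R :> R.
Proof. by rewrite ltr0n expn_gt0. Qed.

Lemma growth_gt0 t : 0 < growth t.
Proof. exact: expR_gt0. Qed.

Lemma approx_tail k j t x : `|t| < (2 ^ k)%:R * h0 -> D x -> D (G x) ->
  `|approx (k + j) t x - approx k t x|
    <= growth t * (4 * t ^+ 2 * `|G (G x)|) / (2 ^ k)%:R.
Proof.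
move=> tk Dx DGx; set c := growth t * (2 * t ^+ 2 * `|G (G x)|).
have c0 : 0 <= c.
  apply: mulr_ge0; first exact: ltW (growth_gt0 t).
  by apply: mulr_ge0 => //; apply: mulr_ge0 => //; exact: sqr_ge0.
(* The partial sum of the geometric series is kept exactly, since the bare bound [2 c / 2^k] is not
   inductive in [j]. *)
suff : `|approx (k + j) t x - approx k t x|
    <= 2 * c / (2 ^ k)%:R - 2 * c / (2 ^ (k + j))%:R.
  move=> /le_trans; apply.
  rewrite (_ : _ * (4 * _ * _) = 2 * c); last by rewrite /c; ring.
  by rewrite lerBlDr lerDl divr_ge0// mulr_ge0.
elim: j => [|j IH]; first by rewrite addn0 !subrr normr0.
have tkj : `|t| < (2 ^ (k + j))%:R * h0.
  by apply: lt_le_trans tk _; rewrite ler_pM2r// ler_nat leq_exp2l// leq_addr.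
have st := approx_step tkj Dx DGx; rewrite -/c in st.
rewrite addnS; apply: le_trans (ler_distD (approx (k + j) t x) _ _) _.
have -> : 2 * c / (2 ^ (k + j).+1)%:R = c / (2 ^ (k + j))%:R.
  by rewrite expnS natrM; field; rewrite gt_eqF// pow2_gt0.
move: IH st; rewrite -![2 * c / _]mulrA.
set q := c / (2 ^ (k + j))%:R; set d1 := `|_|; set d2 := `|_|; lra.
Qed.

Lemma approx_cvgn t x : cvgn (fun k => approx k t x).
Proof.
apply: cvg_of_cauchy_tail => e e0; have b0 := growth_gt0 t.
(* Replacing [x] by [y] in both approximants costs at most [e / 4] each, which leaves [e / 2] for
   the tail at [y]. *)
have [|y [Dy DGy] xy] := @dom_square_dense x (e / (4 * growth t)).
  by rewrite divr_gt0// mulr_gt0.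
set c := growth t * (4 * t ^+ 2 * `|G (G y)|).
have [K1 HK1] := pow2_unbounded (`|t| / h0).
have [K2 HK2] := pow2_unbounded (2 * c / e).
(* [K1] makes the time step admissible and [K2] makes the tail at [y] small. *)
exists (maxn K1 K2) => n; set K := maxn _ _ => Kn.
have tK : `|t| < (2 ^ K)%:R * h0 by rewrite -ltr_pdivrMr// HK1// leq_maxl.
have := HK2 K (leq_maxr _ _); rewrite ltr_pdivrMr// mulrC => cK.
have := approx_tail (n - K) tK Dy DGy; rewrite subnKC// -/c.
rewrite ler_pdivlMr ?pow2_gt0// => yK.
rewrite ltr_pdivlMr ?mulr_gt0// in xy.
have n1 := approx_norm n t (x - y); have n2 := approx_norm K t (x - y).
rewrite !approxB in n1 n2.
have -> : approx n t x - approx K t x = approx n t x - approx n t y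
   - (approx K t x - approx K t y) + (approx n t y - approx K t y).
  by rewrite opprB addrAC !addrA !subrK.
have K0 := pow2_gt0 K.
have m1 : `|approx n t y - approx K t y| <= e / 2.
  by rewrite -(ler_pM2r K0); lra.
apply: le_trans (ler_normD _ _) _.
have := ler_normB (approx n t x - approx n t y) (approx K t x - approx K t y).
lra.
Qed.

(** * The limit group and its invariant domain *)

Definition group t x : V := limn (fun k => approx k t x).
Local Notation T := group.

Lemma group_cvg t x : (fun k => approx k t x) @ \oo --> T t x.
Proof. exact: approx_cvgn. Qed.

Lemma groupD t a x y : T t (a *: x + y) = a *: T t x + T t y.
Proof.
apply: cvg_lim => //.
rewrite (_ : (fun k => _) = (fun k => a *: approx k t x + approx k t y)).
  by apply: cvgD; [apply: cvgZr|]; exact: group_cvg.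
by apply/funext => k; rewrite approxD.
Qed.

Lemma groupB t x y : T t (x - y) = T t x - T t y.
Proof. by rewrite addrC -scaleN1r groupD scaleN1r addrC. Qed.

Lemma group_norm t x : `|T t x| <= growth t * `|x|.
Proof.
by apply: norm_cvg_le (@group_cvg t x) _; apply: nearW => k; exact: approx_norm.
Qed.

Lemma group_id x : T 0 x = x.
Proof.
apply: cvg_lim => //; rewrite (_ : (fun k => _) = cst x); first exact: cvg_cst.
apply/funext => k; rewrite /approx mul0r.
by elim: (2 ^ k)%N => //= n ->; rewrite resolvent_id.
Qed.

Lemma bounded_additive_eq0 (L : V -> V) (K : R) :
  (forall x y, L (x - y) = L x - L y) -> (forall x, `|L x| <= K * `|x|) ->
  (forall x, D x -> D (G x) -> L x = 0) -> forall x, L x = 0.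
Proof.
move=> LB Lb L0 x; apply/eqP; rewrite -normr_le0; apply/ler_addgt0Pl => e e0.
rewrite addr0.
have K0 : 0 < `|K| + 1 by rewrite ltr_wpDl.
have [|y [Dy DGy] xy] := @dom_square_dense x (e / (`|K| + 1));
  first by rewrite divr_gt0.
rewrite -[L x]subr0 -(L0 y Dy DGy) -LB; apply: le_trans (Lb _) _.
apply: le_trans (ler_wpM2r (normr_ge0 _) (_ : K <= `|K| + 1)) _.
  by rewrite (le_trans (ler_norm K))// lerDl.
by rewrite mulrC -ler_pdivlMr// ltW.
Qed.

Lemma group_add s t x : T s (T t x) = T (s + t) x.
Proof.
apply/eqP; rewrite -subr_eq0; apply/eqP; move: x.
apply: (@bounded_additive_eq0 (fun x => T s (T t x) - T (s + t) x)
         (growth s * growth t + growth (s + t))).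
- by move=> x y; rewrite !groupB !opprD !opprK addrACA.
- move=> x; apply: le_trans (ler_normB _ _) _;
  rewrite mulrDl lerD ?group_norm//.
  apply: le_trans (group_norm _ _) _; rewrite -mulrA ler_wpM2l ?group_norm//.
  exact: ltW (growth_gt0 _).
move=> x Dx DGx.
set c := expR (2 * w * (`|s| + `|t|)) * (8 * `|s * t| * `|G (G x)|).
have c0 : 0 <= c by rewrite !mulr_ge0 ?expR_ge0.
have [K HK] := pow2_unbounded ((`|s| + `|t|) / h0).
have cst_ : (fun k => approx k s (approx k t x) - approx k (s + t) x) @ \oo -->
    T s (T t x) - T (s + t) x.
  apply: cvgB; last exact: group_cvg.
  (* The composites converge because the outer maps are bounded uniformly in [k]: compare both terms
     with [approx k s (T t x)]. *)
  apply/cvgrPdist_le => e e0.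
  have /cvgrPdist_le/(_ (e / 2 / growth s)) := @group_cvg t x.
  have b0 := growth_gt0 s; move=> /(_ ltac:(by rewrite !divr_gt0)) H1.
  have /cvgrPdist_le/(_ (e / 2)) := @group_cvg s (T t x).
  move=> /(_ ltac:(by rewrite !divr_gt0)) H2.
  near=> k.
  have : `|T t x - approx k t x| <= e / 2 / growth s by near: k.
  rewrite ler_pdivlMr// mulrC => h1.
  have h2 : `|T s (T t x) - approx k s (T t x)| <= e / 2 by near: k.
  have := approx_norm k s (T t x - approx k t x); rewrite approxB => h3.
  have := ler_distD (approx k s (T t x)) (T s (T t x)) (approx k s (approx k t
    x)).
  lra.
apply/eqP; rewrite -normr_le0; apply/ler_addgt0Pl => e e0; rewrite addr0.
have [K' HK'] := pow2_unbounded (c / e).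
apply: norm_cvg_le cst_ _; exists (maxn K K') => // k /=; rewrite geq_max.
move=> /andP[kK kK'].
have := @resolvent_iter_group (2 ^ k) s t x _ _ Dx DGx; rewrite -/c.
move=> /(_ ltac:(by rewrite expn_gt0)).
rewrite -ltr_pdivrMr// HK// => /(_ isT) /le_trans; apply.
by rewrite ler_pdivrMr ?pow2_gt0// mulrC -ler_pdivrMr// ltW// HK'.
Unshelve. all: by end_near. Qed.

Lemma group_resolvent t h x : T t (J h x) = J h (T t x).
Proof.
apply: cvg_lim => //.
rewrite (_ : (fun k => _) = J h \o (fun k => approx k t x)).
  apply: (@cvg_bounded_additive _ _ _ 2); last exact: group_cvg.
  - by move=> y z; rewrite resolventB.
  - by move=> y; exact: resolvent_norm2.
by apply/funext => k; rewrite /= /approx resolvent_iter_comm.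
Qed.

(** [D] is the range of [J h], and [T t] commutes with [J h]; commutation with [G] is then read off
    the resolvent equation. *)
Lemma group_dom t x : D x -> D (T t x) /\ G (T t x) = T t (G x).
Proof.
move=> Dx; have [h h_gt0 hh] : exists2 h : R, 0 < h & 0 < `|h| < h0.
  have h2 : 0 < h0 / 2 by rewrite divr_gt0.
  by exists (h0 / 2) => //; rewrite gtr0_norm// h2; lra.
have /andP[_ hlt] := hh.
have xE : x = J h (x - h *: G x) by rewrite (resolvent_eq hlt Dx erefl).
have TE : T t x = J h (T t (x - h *: G x)) by rewrite -group_resolvent -xE.
have [DJ JE] := resolventP (T t (x - h *: G x)) hh; rewrite -TE in DJ JE.
split=> //; apply: (scalerI (lt0r_neq0 h_gt0)).
have -> : h *: G (T t x) = T t x - T t (x - h *: G x)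
  by rewrite -JE opprB addrC subrK.
by rewrite -groupB opprB addrC subrK -[_ *: _]addr0 groupD -(subrr x) groupB
  subrr addr0.
Qed.

(** * Differentiability of the group *)

Lemma resolvent_iter_sub n h x : `|h| < h0 -> D x ->
  `|iter n (J h) x - x|
    <= expR (2 * w * (n%:R * `|h|)) * (n%:R * `|h| * (2 * `|G x|)).
Proof.
move=> hh Dx; have w2 : 0 <= 2 * w * `|h| by rewrite mulr_ge0// mulr_ge0.
have p1 : 1 <= expR (2 * w * `|h|) by rewrite -[leLHS]expR0 ler_expR.
have idn m : iter m id x = x by elim: m => //= m ->.
rewrite -{2}(idn n); apply: le_trans (iter_dist n x p1 _ _ _ _ _) _ => //.
- by move=> y z; rewrite resolventB.
- by move=> y; exact: resolvent_norm.
- by move=> y; rewrite ler_peMl.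
rewrite -expRM_natl mulrCA resolvent_sub// normrZ.
rewrite (mulrC n%:R (expR _)) -!mulrA ler_wpM2l ?expR_ge0//.
by rewrite !ler_wpM2l// resolvent_norm2.
Qed.

(** Equicontinuity of the iterates at time [0]. It is needed at [z = G x], which may lie outside
    [D], hence the detour through a nearby [y] in [D]. *)
Lemma resolvent_iter_near z (e : R) : 0 < e -> exists2 d : R, 0 < d &
  forall n h, `|h| < h0 -> n%:R * `|h| < d -> `|iter n (J h) z - z| <= e.
Proof.
move=> e0; pose E := expR (2 * w); have E0 : 0 < E by exact: expR_gt0.
have E1 : 0 < E + 1 by rewrite addr_gt0.
have [|y Dy zy] := D_dense z (_ : 0 < e / 2 / (E + 1));
  first by rewrite !divr_gt0.
have Gy0 := normr_ge0 (G y).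
have q0 : 0 < E * (2 * (`|G y| + 1)) by rewrite !mulr_gt0// ltr_wpDl.
(* The cap [1] bounds the growth factor by [E]; the [+ 1] keeps the denominator positive when
   [G y = 0]. *)
exists (Num.min 1 (e / 2 / (E * (2 * (`|G y| + 1))))).
  by rewrite lt_min ltr01 !divr_gt0.
move=> n h hh; rewrite lt_min => /andP[n1]; rewrite ltr_pdivlMr// => n2.
have nh0 : 0 <= n%:R * `|h| by rewrite mulr_ge0.
have En : expR (2 * w * (n%:R * `|h|)) <= E.
  by rewrite ler_expR ler_piMr ?mulr_ge0// ltW.
rewrite ltr_pdivlMr// in zy.
have -> : iter n (J h) z - z =
    iter n (J h) (-1 *: y + z) + (iter n (J h) y - y) - (z - y).
  rewrite resolvent_iterD !scaleN1r opprB [- iter _ _ _ + _]addrC.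
  by rewrite !addrA !subrK.
apply: le_trans (ler_normB _ _) _.
have := ler_normD (iter n (J h) (-1 *: y + z)) (iter n (J h) y - y).
have := resolvent_iter_norm n h (-1 *: y + z).
have := resolvent_iter_sub n hh Dy.
rewrite scaleN1r [- y + z]addrC.
have := ler_wpM2r (normr_ge0 (z - y)) En.
have := ler_wpM2r (_ : 0 <= n%:R * `|h| * (2 * `|G y|)) En.
move=> /(_ ltac:(by rewrite !mulr_ge0)).
have : 0 <= n%:R * `|h| * E by rewrite mulr_ge0// ltW.
move: zy n2; rewrite -/E; clearbody E => *; lra.
Qed.

(** Discrete counterpart of writing [T t x - x] as the integral of [T s (G x)]: by [resolvent_sub]
    the step from [j] to [j + 1] adds [h J h ^ (j+1) (G x)]. *)
Lemma resolvent_iter_linear n h x (e : R) : `|h| < h0 -> D x ->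
  (forall j, (j <= n)%N -> `|iter j (J h) (G x) - G x| <= e) ->
  `|iter n (J h) x - x - (n%:R * h) *: G x| <= e * (n%:R * `|h|).
Proof.
move=> hh Dx; elim: n => [|n IH] Hj.
  by rewrite !mul0r mulr0 scale0r subr0 subrr normr0.
have /IH IHn : forall j, (j <= n)%N -> `|iter j (J h) (G x) - G x| <= e.
  by move=> j jn; apply: Hj; exact: leqW.
have -> : iter n.+1 (J h) x - x - (n.+1%:R * h) *: G x =
   (iter n (J h) x - x - (n%:R * h) *: G x)
   + h *: (iter n.+1 (J h) (G x) - G x).
  rewrite -(natr1 n) mulrDl mul1r scalerDl opprD.
  rewrite [iter n.+1 _ (G x)]iterSr.
  have -> : h *: (iter n (J h) (J h (G x)) - G x)
     = iter n.+1 (J h) x - iter n (J h) x - h *: G x.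
    rewrite iterSr -[J h x](subrK x) resolvent_sub// resolvent_iterD scalerBr.
    by rewrite addrK.
  rewrite [RHS]addrACA; congr (_ + _).
  by rewrite [RHS]addrC addrA subrK.
rewrite (le_trans (ler_normD _ _))// -(natr1 n) mulrDl mul1r mulrDr lerD//.
by rewrite normrZ mulrC ler_wpM2r// Hj.
Qed.

Lemma group_derivative0 x (e : R) : D x -> 0 < e -> exists2 d : R, 0 < d &
  forall h, `|h| < d -> `|T h x - x - h *: G x| <= e * `|h|.
Proof.
move=> Dx e0; have [d d0 Hd] := resolvent_iter_near (G x) e0.
exists (Num.min d h0); first by rewrite lt_min d0.
move=> h; rewrite lt_min => /andP[hd hh0].
apply: (@norm_cvg_le _ _ (fun k => approx k h x - x - h *: G x)).
  by apply: cvgB; [apply: cvgB;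
    [exact: group_cvg|exact: cvg_cst]|exact: cvg_cst].
apply: nearW => k; have k0 := pow2_gt0 k.
have nE : (2 ^ k)%:R * `|h / (2 ^ k)%:R| = `|h|.
  by rewrite normrM normfV (ger0_norm (ltW k0)) mulrC divfK// gt_eqF.
have hE : (2 ^ k)%:R * (h / (2 ^ k)%:R) = h by rewrite mulrC divfK// gt_eqF.
have hh : `|h / (2 ^ k)%:R| < h0.
  apply: small_quotient; first by rewrite expn_gt0.
  by apply: lt_le_trans hh0 _; rewrite ler_peMl ?(ltW h0_gt0)// ler1n expn_gt0.
have := @resolvent_iter_linear (2 ^ k) _ x e hh Dx; rewrite hE nE; apply.
move=> j jk; apply: Hd => //; apply: le_lt_trans hd; rewrite -[leRHS]nE.
by rewrite ler_wpM2r// ler_nat.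
Qed.

Lemma group_derivative t0 t x : D x ->
  has_derivative (fun t => T (t - t0) x) t (G (T (t - t0) x)).
Proof.
move=> Dx e e0; have b0 := growth_gt0 (t - t0).
have [|d d0 Hd] := @group_derivative0 x (e / growth (t - t0)) Dx.
  by rewrite divr_gt0.
exists d => // h /Hd {}Hd; have [_ ->] := group_dom (t - t0) Dx.
rewrite (addrAC t h) -(group_add (t - t0) h).
have -> : T (t - t0) (T h x) - T (t - t0) x - h *: T (t - t0) (G x) =
    T (t - t0) (T h x - x - h *: G x).
  by rewrite -groupB [LHS]addrC -!scaleNr -groupD [- h *: _ + _]addrC.
apply: le_trans (group_norm _ _) _.
by rewrite -ler_pdivlMl// mulrA [_^-1 * e]mulrC.
Qed.

Lemma derivative_group_eq0 (v : R -> V) t0 :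
  (forall t, D (v t) /\ has_derivative v t (G (v t))) -> v t0 = 0 ->
  forall t, v t = 0.
Proof.
move=> Hv v0 t; rewrite -(group_id (v t)) -(subrr t).
have T0 s : T s 0 = 0 by rewrite -[in LHS](subrr 0) groupB subrr.
rewrite -(T0 (t - t0)) -v0.
apply: (@has_derivative0_cst _ _ (fun s => T (t - s) (v s))) => s e e0.
have [Dv dv] := Hv s.
(* [B] bounds [T (t - (s + h))] for all [|h| < 1]. *)
set B := growth (`|t - s| + 1); have B0 : 0 < B by exact: growth_gt0.
have eB : 0 < e / 2 / B by rewrite !divr_gt0.
have [d1 d10 Hd1] := dv _ eB; have [d2 d20 Hd2] := group_derivative0 Dv eB.
exists (Num.min 1 (Num.min d1 d2)); first by rewrite !lt_min ltr01 d10.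
move=> h; rewrite !lt_min => /and3P[h1 /Hd1 {}Hd1 /Hd2 {}Hd2].
rewrite scaler0 subr0.
(* The increment thus becomes [T (t - (s + h))] applied to [v (s + h) - T h (v s)], a difference of
   two curves with the same value and derivative at [h = 0]. *)
have -> : T (t - s) (v s) = T (t - (s + h)) (T h (v s)).
  by rewrite group_add opprD addrA subrK.
rewrite -groupB; apply: le_trans (group_norm _ _) _.
have bB : growth (t - (s + h)) <= B.
  rewrite ler_expR ler_wpM2l ?mulr_ge0// [leRHS]ger0_norm ?addr_ge0//.
  by rewrite opprD addrA (le_trans (ler_normB _ _))// lerD2l ltW.
apply: le_trans (ler_wpM2r (normr_ge0 _) bB) _.
rewrite -ler_pdivlMl// [leRHS]mulrA [_^-1 * e]mulrC.
have -> : v (s + h) - T h (v s) =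
  v (s + h) - v s - h *: G (v s) - (T h (v s) - v s - h *: G (v s)).
  by rewrite !opprB addrA subrK [_ + (v s - _)]addrA subrK.
have := ler_normB (v (s + h) - v s - h *: G (v s)) (T h (v s) - v s - h *: G
  (v s)).
clearbody B; lra.
Qed.

Theorem generator_solution t0 x : D x -> exists u : R -> V,
  u t0 = x /\ forall t, D (u t) /\ has_derivative u t (G (u t)).
Proof.
move=> Dx; exists (fun t => T (t - t0) x); split;
  first by rewrite subrr group_id.
by move=> t; split; [have [] := group_dom (t - t0) Dx|exact: group_derivative].
Qed.

Theorem generator_unique t0 (u v : R -> V) :
  (forall t, D (u t) /\ has_derivative u t (G (u t))) ->
  (forall t, D (v t) /\ has_derivative v t (G (v t))) ->
  u t0 = v t0 -> forall t, u t = v t.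
Proof.
move=> Hu Hv uv0 t; apply/eqP; rewrite -subr_eq0; apply/eqP.
apply: (@derivative_group_eq0 (fun t => u t - v t) t0);
  last by rewrite uv0 subrr.
move=> {}t; have [Du du] := Hu t; have [Dv dv] := Hv t.
split=> [|e e0]; first by rewrite -(scale1r (v t)); exact: dom_subr.
have e2 : 0 < e / 2 by rewrite divr_gt0.
have [d1 d10 Hd1] := du _ e2; have [d2 d20 Hd2] := dv _ e2.
exists (Num.min d1 d2); first by rewrite lt_min d10.
move=> h; rewrite lt_min => /andP[/Hd1 {}Hd1 /Hd2 {}Hd2].
have -> : G (u t - v t) = G (u t) - G (v t).
  by have := gen_subr 1 Du Dv; rewrite !scale1r.
have -> : u (t + h) - v (t + h) - (u t - v t) - h *: (G (u t) - G (v t)) =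
  u (t + h) - u t - h *: G (u t) - (v (t + h) - v t - h *: G (v t)).
  by rewrite scalerBr !opprD !opprK (addrACA (u (t + h))) [LHS]addrACA.
have := ler_normB (u (t + h) - u t - h *: G (u t)) (v (t + h) - v t - h *: G
  (v t)).
lra.
Qed.
End Generator.

(** * Hilbert spaces *)

Section InnerProduct.
Variables (R : realType) (X : lmodType R[i]) (ip : X -> X -> R[i]).
Hypothesis HI : is_inner_product ip.
Implicit Types (x y z : X).
Local Notation N := (hnorm ip).

(** The inner product of the underlying real Hilbert space, with the same norm; imaginary parts are
    recovered by [rip_i]. *)
Definition rip x y : R := complex.Re (ip x y).

Lemma ReD (p q : R[i]) : complex.Re (p + q) = complex.Re p + complex.Re q.
Proof. by case: p; case: q. Qed.

Lemma ReM_real (r : R) (p : R[i]) : complex.Re (r%:C%C * p) = r * complex.Re p.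
Proof. by case: p => a b; rewrite /= mul0r subr0. Qed.

Lemma ripC x y : rip x y = rip y x.
Proof. by have [c _ _ _] := HI; rewrite /rip c; case: (ip y x). Qed.

Lemma ripD x y z : rip x (y + z) = rip x y + rip x z.
Proof.
by have [_ l _ _] := HI; rewrite /rip -[y]scale1r l mul1r scale1r ReD.
Qed.

Lemma ip0 x : ip x 0 = 0.
Proof.
have [_ l _ _] := HI; have := l 1 x 0 0.
by rewrite scale1r addr0 mul1r -[X in X = _]addr0 => /addrI <-.
Qed.

Lemma ipZ x (c : R[i]) y : ip x (c *: y) = c * ip x y.
Proof. by have [_ l _ _] := HI; rewrite -[c *: y]addr0 l ip0 addr0. Qed.

Lemma rip0 x : rip x 0 = 0.
Proof. by rewrite /rip ip0. Qed.

Lemma ripZ x (r : R) y : rip x (r%:C%C *: y) = r * rip x y.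
Proof. by rewrite /rip ipZ ReM_real. Qed.

Lemma ripN x y : rip x (- y) = - rip x y.
Proof.
by apply/eqP; rewrite -subr_eq0 opprK -ripD addNr rip0.
Qed.

Lemma ripB x y z : rip x (y - z) = rip x y - rip x z.
Proof. by rewrite ripD ripN. Qed.

Lemma rip_i x y : rip ('i%C *: x) y = complex.Im (ip x y).
Proof.
have [c _ _ _] := HI; rewrite /rip c ipZ [ip x y]c.
by case: (ip y x) => a b /=; rewrite mul0r mul1r sub0r.
Qed.

Lemma rip_ii x y : rip ('i%C *: x) ('i%C *: y) = rip x y.
Proof.
by rewrite rip_i ipZ /rip; case: (ip x y) => a b /=; rewrite mul0r mul1r add0r.
Qed.

Lemma rip_ge0 x : 0 <= rip x x.
Proof.
have [_ _ p _] := HI; have := p x; rewrite /rip lecE => /andP[_].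
by [].
Qed.

Lemma ip_self x : ip x x = (rip x x)%:C%C.
Proof.
have [_ _ p _] := HI; have := p x; rewrite /rip lecE => /andP[/eqP + _].
by case: (ip x x) => a b /= ->.
Qed.

Lemma rip_eq0 x : rip x x = 0 -> x = 0.
Proof.
by have [_ _ _ p] := HI => x0; apply: p; rewrite ip_self x0.
Qed.

Lemma hnorm_sqr x : N x ^+ 2 = rip x x.
Proof. by rewrite sqr_sqrtr ?rip_ge0. Qed.

Lemma hnorm_ge0 x : 0 <= N x.
Proof. exact: sqrtr_ge0. Qed.

Lemma hnorm0 : N 0 = 0.
Proof. by rewrite /hnorm -/(rip 0 0) rip0 sqrtr0. Qed.

Lemma hnormD_sqr x y : N (x + y) ^+ 2 = N x ^+ 2 + N y ^+ 2 + 2 * rip x y.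
Proof.
by rewrite !hnorm_sqr ripD ![rip (x + y) _]ripC !ripD [rip y x]ripC; ring.
Qed.

Lemma hnormN x : N (- x) = N x.
Proof. by rewrite /hnorm -/(rip _ _) -/(rip _ _) ripN ripC ripN opprK. Qed.

Lemma hnormB_sqr x y : N (x - y) ^+ 2 = N x ^+ 2 + N y ^+ 2 - 2 * rip x y.
Proof. by rewrite hnormD_sqr hnormN ripN mulrN. Qed.

Lemma hnormZ (r : R) x : N (r%:C%C *: x) = `|r| * N x.
Proof.
rewrite /hnorm -/(rip _ _) -/(rip _ _) ripZ ripC ripZ mulrA -expr2.
by rewrite sqrtrM ?sqr_ge0// sqrtr_sqr.
Qed.

Lemma hnorm_i x : N ('i%C *: x) = N x.
Proof. by rewrite /hnorm -/(rip _ _) -/(rip _ _) rip_ii. Qed.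

Lemma hnorm_eq0 x : N x = 0 -> x = 0.
Proof. by move=> x0; apply: rip_eq0; rewrite -hnorm_sqr x0 expr0n. Qed.

(** Cauchy-Schwarz, by expanding the square of the norm of [|y| x - |x| y]. *)
Lemma rip_le x y : rip x y <= N x * N y.
Proof.
have [y0|y0] := eqVneq (N y) 0.
  by rewrite y0 mulr0 (hnorm_eq0 y0) rip0.
have [x0|x0] := eqVneq (N x) 0.
  by rewrite x0 mul0r (hnorm_eq0 x0) ripC rip0.
have xp : 0 < N x by rewrite lt_def x0 hnorm_ge0.
have yp : 0 < N y by rewrite lt_def y0 hnorm_ge0.
have := sqr_ge0 (N ((N y)%:C%C *: x - (N x)%:C%C *: y)).
rewrite hnormB_sqr !hnormZ (ger0_norm (ltW xp)) (ger0_norm (ltW yp)) ripZ ripC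
  ripZ ripC.
have -> : (N y * N x) ^+ 2 + (N x * N y) ^+ 2 - 2 * (N x * (N y * rip x y))
  = 2 * (N x * N y) * (N x * N y - rip x y) by ring.
by rewrite pmulr_rge0 ?subr_ge0// !mulr_gt0.
Qed.

Lemma rip_norm_le x y : `|rip x y| <= N x * N y.
Proof.
rewrite ler_norml rip_le andbT lerNl -ripN.
by apply: le_trans (rip_le _ _) _; rewrite hnormN.
Qed.

Lemma hnormD x y : N (x + y) <= N x + N y.
Proof.
rewrite -(@ler_pXn2r _ 2)// ?nnegrE ?addr_ge0 ?hnorm_ge0//.
by rewrite hnormD_sqr; have := rip_le x y; lra.
Qed.

End InnerProduct.

(* [X] with real scalars; the proof [H] is a parameter so that the norm and its
   completeness can be attached as canonical structures. *)
Definition realification (R : realType) (X : lmodType R[i]) (ip : X -> X ->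
  R[i])
  (H : is_hilbert ip) : Type := X.

Lemma invS_lt (R : realType) (e : R) : 0 < e ->
  exists M, forall n, (M <= n)%N -> n.+1%:R^-1 < e.
Proof.
move=> e0; exists (Num.bound e^-1) => n Mn.
rewrite -[e]invrK ltf_pV2 ?posrE ?invr_gt0//.
have := archi_boundP (ltW (_ : 0 < e^-1)); rewrite invr_gt0 => /(_ e0).
by move=> /lt_trans; apply; rewrite ltr_nat ltnS.
Qed.

(** * The realification as a complete normed space *)

Section Realification.
Variables (R : realType) (X : lmodType R[i]) (ip : X -> X -> R[i]).
Variable H : is_hilbert ip.
Local Notation V := (realification H).

HB.instance Definition _ := GRing.Zmodule.copy V X.

Let scale (r : R) (x : V) : V := r%:C%C *: (x : X).

Let scaleA (a b : R) (x : V) : scale a (scale b x) = scale (a * b) x.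
Proof. by rewrite /scale scalerA -rmorphM. Qed.
Let scale1 : left_id 1 scale.
Proof. by move=> x; rewrite /scale rmorph1 scale1r. Qed.
Let scaleDr : right_distributive scale +%R.
Proof. by move=> r x y; rewrite /scale scalerDr. Qed.
Let scaleDl (x : V) : {morph scale^~ x : a b / a + b}.
Proof. by move=> a b; rewrite /scale rmorphD scalerDl. Qed.

HB.instance Definition _ :=
  GRing.Zmodule_isLmodule.Build R V scaleA scale1 scaleDr scaleDl.

HB.instance Definition _ := Lmodule_isNormed.Build R V
  (hnormD (proj1 H)) (hnormZ (proj1 H)) (@hnorm_eq0 _ _ _ (proj1 H)).

(** [hcomplete] speaks of sequences only. Centres of balls of radius [1 / (n + 1)] belonging to [F]
    form a Cauchy sequence, and [F] converges to its limit. *)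
Let complete (F : set_system V) : ProperFilter F -> cauchy F -> cvg F.
Proof.
move=> FF /cauchyP Fc.
have /choice[x Fx] : forall n, exists x : V, F (ball x (n.+1%:R^-1 : R)).
  by move=> n; apply: Fc; rewrite invr_gt0.
have inter n m : `|x n - x m| < n.+1%:R^-1 + m.+1%:R^-1.
  have [z [/= z1 z2]] := filter_ex (filterI (Fx n) (Fx m)).
  move: z1 z2; rewrite -ball_normE /= => z1 z2.
  by apply: le_lt_trans (ler_distD z _ _) _; rewrite [`|z - _|]distrC ltrD.
have [|l Hl] := proj2 H x.
  move=> e e0; have [|M HM] := @invS_lt R (e / 2); first by rewrite divr_gt0.
  exists M => m n Mm Mn; apply: lt_le_trans (inter m n) _.
  by rewrite (splitr e); apply/ltW/ltrD; exact: HM.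
apply/cvg_ex; exists (l : V); apply/cvgrPdist_lt => e e0.
have [|M HM] := @invS_lt R (e / 2); first by rewrite divr_gt0.
have [|K HK] := Hl (e / 2); first by rewrite divr_gt0.
have := Fx (maxn M K); apply: filterS => z; rewrite -ball_normE /= => xz.
have h1 := HM _ (leq_maxl M K); have h2 : `|x (maxn M K) - (l : V)| < e / 2.
  exact: HK (leq_maxr M K).
apply: le_lt_trans (ler_distD (x (maxn M K)) _ _) _.
by rewrite (distrC (l : V)) (splitr e) ltrD// (lt_trans xz).
Qed.

HB.instance Definition _ := Uniform_isComplete.Build V complete.
End Realification.

(** * Surjectivity by orthogonal projection onto the range *)

Section Surjectivity.
Variables (R : realType) (X : lmodType R[i]) (ip : X -> X -> R[i]).
Hypothesis H : is_hilbert ip.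
Local Notation N := (hnorm ip).
Local Notation "x ## y" := (rip ip x y) (at level 40).
Local Notation HI := (proj1 H).
(** The pair is used with [T' = T] self-adjoint, and with [free_map h] and its adjoint
    [free_map (- h)]. *)
Variables (D : X -> Prop) (T T' : X -> X) (m : R).
Hypotheses (m_gt0 : 0 < m) (D0 : D 0).
Hypothesis D_sub : forall (r : R) x y, D x -> D y -> D (r%:C%C *: x + y).
Hypothesis T_lin :
  forall (r : R) x y, D x -> D y -> T (r%:C%C *: x + y) = r%:C%C *: T x + T y.
Hypothesis T_low : forall x, D x -> m * N x <= N (T x).
Hypothesis T_adj : forall x y, D x -> D y -> T' x ## y = x ## T y.
Hypothesis T_max : forall x y,
  (forall w, D w -> T' w ## x = w ## y) -> D x /\ T x = y.
Hypothesis T_coker : forall z, (forall w, D w -> T w ## z = 0) -> z = 0.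

Lemma linear_subr x y : D x -> D y -> D (x - y) /\ T (x - y) = T x - T y.
Proof.
move=> Dx Dy; have e : (-1 : R)%:C%C *: y + x = x - y.
  by rewrite rmorphN1 scaleN1r addrC.
by rewrite -e; split; [exact: D_sub|rewrite T_lin// rmorphN1 scaleN1r addrC].
Qed.

Lemma range_midpoint x y : D x -> D y -> exists2 z, D z & T z + T z = T x + T y.
Proof.
move=> Dx Dy; have Dxy : D (x + y) by rewrite -[x]scale1r; exact: (@D_sub 1).
have TD : T (x + y) = T x + T y.
  by rewrite -[x in LHS]scale1r (@T_lin 1)// scale1r.
have half v : (2^-1 : R)%:C%C *: v + (2^-1 : R)%:C%C *: v = v.
  rewrite -scalerDl -rmorphD (_ : 2^-1 + 2^-1 = 1) ?scale1r//.
  by field.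
exists ((2^-1 : R)%:C%C *: (x + y)).
  by rewrite -[_ *: _]addr0; exact: D_sub.
have T0 : T 0 = 0 by have [_] := linear_subr D0 D0; rewrite !subrr.
by rewrite -[_ *: _]addr0 T_lin// T0 addr0 half TD.
Qed.

(* The point of the range nearest to [y] exists by the parallelogram law, and
   the residual is orthogonal to the range. *)
Lemma adjoint_pair_surj y : exists2 x, D x & T x = y.
Proof.
pose E := [set r : R | exists2 x, D x & r = N (y - T x)].
have E0 : E !=set0 by exists (N (y - T 0)); exists 0.
have Elb : has_lbound E by exists 0 => _ [x _ ->]; exact: hnorm_ge0.
pose d := inf E.
have dle x : D x -> d <= N (y - T x) by move=> Dx; apply: ge_inf => //;
  exists x.
have d0 : 0 <= d by apply: lb_le_inf => // _ [x _ ->]; exact: hnorm_ge0.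
have near_inf n : exists x, D x /\ N (y - T x) < d + n.+1%:R^-1.
  have n0 : 0 < n.+1%:R^-1 :> R by rewrite invr_gt0.
  have [_ [x Dx ->] lt] := inf_adherent n0 (conj E0 Elb).
  by exists x.
have [u /all_and2[Du Nu]] := choice near_inf.
(* Parallelogram law for [y - T x'] and [y - T x], whose sum is twice [y - T z] and so has norm at
   least [2 d]. *)
have par x x' : D x -> D x' -> N (T x - T x') ^+ 2 <=
    2 * N (y - T x) ^+ 2 + 2 * N (y - T x') ^+ 2 - 4 * d ^+ 2.
  move=> Dx Dx'; have [z Dz zE] := range_midpoint Dx Dx'.
  have -> : T x - T x' = (y - T x') - (y - T x).
    by rewrite opprB [RHS]addrC addrA subrK.
  have := hnormB_sqr HI (y - T x') (y - T x).
  have := hnormD_sqr HI (y - T x') (y - T x).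
  have -> : y - T x' + (y - T x) = (2 : R)%:C%C *: (y - T z).
    rewrite rmorph_nat scaler_nat mulr2n addrACA -opprD [T x' + _]addrC -zE.
    by rewrite opprD addrACA.
  rewrite (hnormZ HI) ger0_norm//.
  have := dle _ Dz; have := hnorm_ge0 ip (y - T z).
  rewrite exprMn => z0 dz.
  have : d ^+ 2 <= N (y - T z) ^+ 2 by rewrite ler_pXn2r.
  lra.
have TC e : 0 < e -> exists K, forall k n, (K <= k)%N -> (K <= n)%N ->
    N (T (u k) - T (u n)) < e.
  (* For [0 <= r <= 1], [4 (d + r)^2 - 4 d^2 <= (8 d + 4) r]. *)
  move=> e0; have [|K HK] := @invS_lt R (Num.min 1 (e ^+ 2 / (8 * d + 4))).
    by rewrite lt_min ltr01 divr_gt0 ?exprn_gt0//; lra.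
  exists K => k n Kk Kn; rewrite -(@ltr_pXn2r _ 2)// ?nnegrE ?hnorm_ge0 ?(ltW
    e0)//.
  apply: le_lt_trans (par _ _ (Du k) (Du n)) _.
  have := HK K (leqnn K); rewrite lt_min ltr_pdivlMr; last by lra.
  move=> /andP[r1 re].
  have Nr l : (K <= l)%N -> N (y - T (u l)) ^+ 2 <= (d + K.+1%:R^-1) ^+ 2.
    move=> Kl; rewrite ler_pXn2r ?nnegrE ?hnorm_ge0 ?addr_ge0 ?invr_ge0//.
    by apply: le_trans (ltW (Nu l)) _;
      rewrite lerD2l lef_pV2 ?posrE// ler_nat ltnS.
  have := Nr _ Kk; have := Nr _ Kn; move: r1 re.
  have : 0 <= K.+1%:R^-1 :> R by rewrite invr_ge0.
  move: (K.+1%:R^-1) => r r0 r1 re.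
  move: (N _ ^+ 2) (N _ ^+ 2) => A B; nra.
have [z Hz] := proj2 H (T \o u) TC.
have [|x Hx] := proj2 H u.
  move=> e e0; have [|K HK] := TC (m * e); first by rewrite mulr_gt0.
  exists K => k n Kk Kn; have := HK k n Kk Kn.
  have [Dkn <-] := linear_subr (Du k) (Du n).
  by move=> /(le_lt_trans (T_low Dkn)); rewrite ltr_pM2l.
(* [T_max] acts as closedness of [T]: the adjoint relation passes to the limit along [u]. *)
have [Dx Tx] : D x /\ T x = z.
  apply: T_max => v Dv; apply/eqP; rewrite -subr_eq0 -normr_le0.
  apply/ler_addgt0Pl => e e0; rewrite addr0.
  have q0 : 0 < N (T' v) + N v + 1 by rewrite ltr_wpDl// addr_ge0 ?hnorm_ge0.
  have [|K1 HK1] := Hx (e / (N (T' v) + N v + 1)); first by rewrite divr_gt0.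
  have [|K2 HK2] := Hz (e / (N (T' v) + N v + 1)); first by rewrite divr_gt0.
  have := HK1 _ (leq_maxl K1 K2); have := HK2 _ (leq_maxr K1 K2).
  move: (maxn K1 K2) => n /=; rewrite !ltr_pdivlMr// => z1 x1.
  have -> : T' v ## x - v ## z = v ## (T (u n) - z) - T' v ## (u n - x).
    by rewrite !(ripB HI) (T_adj Dv (Du n)); ring.
  have := rip_norm_le HI v (T (u n) - z);
    have := rip_norm_le HI (T' v) (u n - x).
  have := ler_normB (v ## (T (u n) - z)) (T' v ## (u n - x)).
  have := hnorm_ge0 ip (T (u n) - z); have := hnorm_ge0 ip (u n - x).
  have := hnorm_ge0 ip (T' v); have := hnorm_ge0 ip v.
  move: z1 x1 q0; move: (N (T _ - _)) (N (_ - x)) (N (T' v)) (N v) => a b c f.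
  move=> z1 x1 q0 f0 c0 b0 a0 l1 l2 l3; have [ab|ba] := leP a b.
    have := ler_wpM2l f0 ab; lra.
  have := ler_wpM2l c0 (ltW ba); lra.
have yz : N (y - z) <= d.
  apply/ler_addgt0Pl => e e0; have e2 : 0 < e / 2 by rewrite divr_gt0.
  have [K1 HK1] := Hz _ e2; have [K2 HK2] := invS_lt e2.
  have := HK1 _ (leq_maxl K1 K2); have := HK2 _ (leq_maxr K1 K2).
  move: (maxn K1 K2) => n /= n1 n2; have := Nu n.
  have := hnormD HI (y - T (u n)) (T (u n) - z); rewrite addrA subrK.
  move: n1; move: (n.+1%:R^-1) => r; lra.
exists x => //; rewrite Tx; apply/eqP; rewrite eq_sym -subr_eq0; apply/eqP.
apply: T_coker => v Dv; set r := y - z in yz *.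
(* Nearly the minimizer of [|r - s T v|]; the [+ 1] avoids division by zero. With [q = |T v|^2],
   minimality of [|r|] gives [0 <= - s^2 (q + 2)], hence [s = 0]. *)
pose s := T v ## r / (N (T v) ^+ 2 + 1).
have := dle _ (D_sub s Dv Dx); rewrite (T_lin s Dv Dx) Tx.
have -> : y - (s%:C%C *: T v + z) = r - s%:C%C *: T v
  by rewrite /r opprD addrCA addrC.
clearbody r; move=> /(le_trans yz) rs.
have : N r ^+ 2 <= N (r - s%:C%C *: T v) ^+ 2
  by rewrite ler_pXn2r ?nnegrE ?hnorm_ge0.
rewrite (hnormB_sqr HI) (hnormZ HI) (ripZ HI) exprMn real_normK ?num_real//.
rewrite (ripC HI r).
have q0 : 0 < N (T v) ^+ 2 + 1 by rewrite ltr_wpDl ?sqr_ge0.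
have sE : T v ## r = s * (N (T v) ^+ 2 + 1) by rewrite divfK// gt_eqF.
rewrite sE; move: q0 (sqr_ge0 (N (T v)));
  move: (N (T v) ^+ 2) (N r ^+ 2) => q p.
move=> q0 q1 le; suff -> : s = 0 by rewrite mul0r.
clearbody s; apply/eqP; rewrite -sqrf_eq0; apply/eqP.
have := sqr_ge0 s; nra.
Qed.
End Surjectivity.

(** * The product Hilbert space *)

Section ProductHilbert.
Variables (R : realType) (X : lmodType R[i]) (ip : X -> X -> R[i]).
Hypothesis H : is_hilbert ip.
Implicit Types x y z : (X * X)%type.

Definition ip2 x y : R[i] := ip x.1 y.1 + ip x.2 y.2.

Lemma rip2E x y : rip ip2 x y = rip ip x.1 y.1 + rip ip x.2 y.2.
Proof. by rewrite /rip /ip2 ReD. Qed.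

Lemma ip2_inner : is_inner_product ip2.
Proof.
have [c l p e] := proj1 H; split.
- move=> x y; rewrite /ip2 c [ip x.2 _]c.
  by case: (ip y.1 _) (ip y.2 _) => ? ? [? ?] /=; rewrite opprD.
- by move=> a x y z; rewrite /ip2 /= !l mulrDr addrACA.
- by move=> x; rewrite addr_ge0.
- move=> x /eqP; rewrite paddr_eq0// => /andP[/eqP/e x1 /eqP/e x2].
  by rewrite [x]surjective_pairing x1 x2.
Qed.

Lemma hnorm2_sqr x : hnorm ip2 x ^+ 2 = hnorm ip x.1 ^+ 2 + hnorm ip x.2 ^+ 2.
Proof.
by rewrite (hnorm_sqr ip2_inner) rip2E !(hnorm_sqr (proj1 H)).
Qed.

Lemma hnorm2_ge1 x : hnorm ip x.1 <= hnorm ip2 x.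
Proof.
rewrite -(@ler_pXn2r _ 2)// ?nnegrE ?hnorm_ge0// hnorm2_sqr.
by rewrite lerDl sqr_ge0.
Qed.

Lemma hnorm2_ge2 x : hnorm ip x.2 <= hnorm ip2 x.
Proof.
rewrite -(@ler_pXn2r _ 2)// ?nnegrE ?hnorm_ge0// hnorm2_sqr.
by rewrite lerDr sqr_ge0.
Qed.

Lemma hnorm2_le x : hnorm ip2 x <= hnorm ip x.1 + hnorm ip x.2.
Proof.
rewrite -(@ler_pXn2r _ 2)// ?nnegrE ?addr_ge0 ?hnorm_ge0// hnorm2_sqr.
have := mulr_ge0 (hnorm_ge0 ip x.1) (hnorm_ge0 ip x.2); lra.
Qed.

Lemma ip2_hilbert : is_hilbert ip2.
Proof.
split; first exact: ip2_inner.
move=> u uC; have [|l1 Hl1] := proj2 H (fun n => (u n).1).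
  move=> e /uC[K HK]; exists K => m n Km Kn.
  by apply: le_lt_trans (HK m n Km Kn); exact: (hnorm2_ge1 (u m - u n)).
have [|l2 Hl2] := proj2 H (fun n => (u n).2).
  move=> e /uC[K HK]; exists K => m n Km Kn.
  by apply: le_lt_trans (HK m n Km Kn); exact: (hnorm2_ge2 (u m - u n)).
exists (l1, l2) => e e0; have e2 : 0 < e / 2 by rewrite divr_gt0.
have [K1 HK1] := Hl1 _ e2; have [K2 HK2] := Hl2 _ e2.
exists (maxn K1 K2) => n; rewrite geq_max => /andP[/HK1 n1 /HK2 n2].
apply: le_lt_trans (hnorm2_le _) _; move: n1 n2 => /=; lra.
Qed.
End ProductHilbert.

(** * Self-adjoint operators *)

Section SelfAdjoint.
Variables (R : realType) (X : lmodType R[i]) (ip : X -> X -> R[i]).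
Hypothesis H : is_hilbert ip.
Local Notation N := (hnorm ip).
Local Notation HI := (proj1 H).
Local Notation "x ## y" := (rip ip x y) (at level 40).
Variables (D : X -> Prop) (T : X -> X).
Hypothesis HT : self_adjoint ip D T.

Lemma sa_sub (a : R[i]) x y : D x -> D y -> D (a *: x + y).
Proof. by have [[_ s] _ _ _] := HT; exact: s. Qed.

Lemma sa_dom0 : D 0.
Proof. by have [[s _] _ _ _] := HT. Qed.

Lemma sa_lin (a : R[i]) x y : D x -> D y -> T (a *: x + y) = a *: T x + T y.
Proof. by have [_ l _ _] := HT; exact: l. Qed.

Lemma sa_map0 : T 0 = 0.
Proof.
have := sa_lin 1 sa_dom0 sa_dom0; rewrite !scale1r addr0.
by rewrite -[X in X = _]addr0 => /addrI <-.
Qed.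

Lemma sa_scale (a : R[i]) x : D x -> D (a *: x) /\ T (a *: x) = a *: T x.
Proof.
move=> Dx; rewrite -[a *: x]addr0; split; first exact: sa_sub sa_dom0.
by rewrite sa_lin ?sa_map0 ?addr0//; exact: sa_dom0.
Qed.

Lemma sa_add x y : D x -> D y -> D (x + y) /\ T (x + y) = T x + T y.
Proof.
move=> Dx Dy; rewrite -[x]scale1r; split; first exact: sa_sub.
by rewrite sa_lin ?scale1r.
Qed.

Lemma sa_subr x y : D x -> D y -> D (x - y) /\ T (x - y) = T x - T y.
Proof.
move=> Dx Dy; have [Dn Tn] := sa_scale (-1) Dy.
rewrite -[- y]scaleN1r -[- T y]scaleN1r -Tn.
exact: sa_add.
Qed.

Lemma sa_sym x y : D x -> D y -> T x ## y = x ## T y.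
Proof.
move=> Dx Dy; have [_ _ _ a] := HT.
by rewrite /rip (proj2 (a y (T y)) (conj Dy erefl)).
Qed.

(* Applying the hypothesis to ['i *: w] recovers the imaginary part. *)
Lemma sa_max x y : (forall w, D w -> T w ## x = w ## y) -> D x /\ T x = y.
Proof.
move=> wE; have [_ _ _ a] := HT.
suff /(proj1 (a x y))[Dx ->] : forall w, D w -> ip (T w) x = ip w y by [].
move=> w Dw; apply/eqP; rewrite eq_complex; apply/andP; split; apply/eqP.
  exact: wE.
have [Diw Tiw] := sa_scale 'i%C Dw.
by rewrite -!(rip_i HI) -Tiw; exact: wE.
Qed.

Lemma sa_coercive_surj (eps : R) : 0 < eps ->
  (forall x, D x -> eps * N x ^+ 2 <= x ## T x) ->
  forall y, exists2 x, D x & T x = y.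
Proof.
move=> eps0 co; apply: (@adjoint_pair_surj _ _ _ H _ _ T eps) => //.
- exact: sa_dom0.
- by move=> r x y; exact: sa_sub.
- by move=> r x y; exact: sa_lin.
- move=> x Dx; have [->|x0] := eqVneq (N x) 0.
    by rewrite mulr0 hnorm_ge0.
  have xp : 0 < N x by rewrite lt_def x0 hnorm_ge0.
  rewrite -(ler_pM2l xp) mulrCA -expr2.
  by apply: le_trans (co x Dx) _; exact: (rip_le HI).
- exact: sa_sym.
- exact: sa_max.
(* A vector orthogonal to the range lies in the kernel of the adjoint, here [T] itself, and
   coercivity makes this kernel trivial. *)
move=> z z0; have [|Dz Tz] := @sa_max z 0.
  by move=> w /z0 ->; rewrite (rip0 HI).
apply: (hnorm_eq0 HI); have := co z Dz; rewrite Tz (rip0 HI).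
by rewrite pmulr_rle0// => z1; apply/eqP; rewrite -sqrf_eq0 eq_le z1 sqr_ge0.
Qed.
End SelfAdjoint.

(** * The wave operator *)

Section WaveOperator.
Variables (R : realType) (X : lmodType R[i]) (ip : X -> X -> R[i]).
Hypothesis HX : is_hilbert ip.
Local Notation N := (hnorm ip).
Local Notation HI := (proj1 HX).
Local Notation "x ## y" := (rip ip x y) (at level 40).
Variables (DA : X -> Prop) (A : X -> X).
Hypothesis HA : self_adjoint ip DA A.
Variable eps : R.
Hypothesis Heps : 0 < eps.
Hypothesis HAcoer : forall x : X, DA x -> (eps%:C)%C * ip x x <= ip x (A x).
Variables (DS : X -> Prop) (S : X -> X).
Hypothesis HS : is_pos_sqrt ip DA A DS S.

Let S_sa : self_adjoint ip DS S. Proof. by have [] := HS. Qed.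

Lemma domA x : DA x <-> DS x /\ DS (S x).
Proof. by have [_ _ h _] := HS; exact: h. Qed.

Lemma sqrt_sqrt x : DA x -> S (S x) = A x.
Proof. by have [_ _ _ h] := HS; exact: h. Qed.

Lemma coercive x : DA x -> eps * N x ^+ 2 <= x ## A x.
Proof.
move=> /HAcoer; rewrite lecE => /andP[_].
by rewrite ReM_real -/(rip ip x x) -(hnorm_sqr HI).
Qed.

Lemma sqrt_coercive x : DA x -> eps * N x ^+ 2 <= N (S x) ^+ 2.
Proof.
move=> Dx; apply: le_trans (coercive Dx) _; have /domA[DSx DSSx] := Dx.
by rewrite -sqrt_sqrt// -(sa_sym S_sa)// (hnorm_sqr HI).
Qed.

(** Coercivity is stated on [DA], but a kernel vector of [S] is in [DA] because its image [0] lies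
    in [DS]. *)
Lemma sqrt_inj x y : DS x -> DS y -> S x = S y -> x = y.
Proof.
move=> Dx Dy e; have [Dxy] := sa_subr S_sa Dx Dy; rewrite e subrr => S0.
have DAxy : DA (x - y).
  by apply/domA; split => //; rewrite S0; exact: (sa_dom0 S_sa).
have := sqrt_coercive DAxy; rewrite S0 (hnorm_sqr HI 0) (rip0 HI).
rewrite pmulr_rle0// => z1; apply/eqP; rewrite -subr_eq0; apply/eqP.
by apply: (hnorm_eq0 HI); apply/eqP; rewrite -sqrf_eq0 eq_le z1 sqr_ge0.
Qed.

Definition Sinv (p : X) : X := xget 0 [set u | DS u /\ S u = p].

(** [S] inherits surjectivity from the coercive [A]: if [A x = p], then [S x] is a preimage of
    [p]. *)
Lemma SinvP p : DS (Sinv p) /\ S (Sinv p) = p.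
Proof.
have [x Dx Ax] := sa_coercive_surj HX HA Heps coercive p.
have := @xgetPex _ 0 [set u | DS u /\ S u = p]; apply.
by exists (S x); rewrite /= sqrt_sqrt// Ax; split => //; have /domA[] := Dx.
Qed.

Lemma Sinv_dom p : DS (Sinv p). Proof. by have [] := SinvP p. Qed.
Lemma SinvK p : S (Sinv p) = p. Proof. by have [] := SinvP p. Qed.

Lemma SinvE x : DS x -> Sinv (S x) = x.
Proof. by move=> Dx; apply: sqrt_inj; rewrite ?SinvK//; exact: Sinv_dom. Qed.

Lemma Sinv_lin (a : R[i]) p q : Sinv (a *: p + q) = a *: Sinv p + Sinv q.
Proof.
have [Dp Dq] := (Sinv_dom p, Sinv_dom q).
apply: sqrt_inj; first exact: Sinv_dom.
  exact: (sa_sub S_sa).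
by rewrite SinvK (sa_lin S_sa)// !SinvK.
Qed.

Lemma Sinv_domA p : DS p -> DA (Sinv p).
Proof. by move=> Dp; apply/domA; rewrite SinvK; split => //;
  exact: Sinv_dom. Qed.

(** * The resolvent equation of the skew-adjoint part *)

Section FreeResolvent.
Implicit Types x y z : (X * X)%type.
Local Notation N2 := (hnorm (ip2 ip)).
Local Notation H2 := (ip2_hilbert HX).
Local Notation HI2 := (ip2_inner HX).

Definition dom2 x := DS x.1 /\ DS x.2.
Definition free_map (h : R) x : X * X :=
  (x.1 - h%:C%C *: S x.2, x.2 + h%:C%C *: S x.1).

Lemma dom2_sub (a : R[i]) x y : dom2 x -> dom2 y -> dom2 (a *: x + y).
Proof. by move=> [? ?] [? ?]; split; exact: (sa_sub S_sa). Qed.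

Lemma free_map_lin h (a : R[i]) x y : dom2 x -> dom2 y ->
  free_map h (a *: x + y) = a *: free_map h x + free_map h y.
Proof.
move=> [x1 x2] [y1 y2]; rewrite /free_map /= !(sa_lin S_sa)// !scalerDr
  !scalerA.
rewrite [_ * a]mulrC; congr (_, _) => /=.
  by rewrite opprD addrACA scalerBr scalerA.
by rewrite addrACA scalerDr scalerA.
Qed.

(** The cross terms cancel by symmetry of [S]. The full identity is kept because its term in [S x.2]
    later absorbs [h B]. *)
Lemma free_map_norm h x : dom2 x ->
  N2 (free_map h x) ^+ 2 = N2 x ^+ 2 + h ^+ 2 * (N (S x.2) ^+ 2 + N (S x.1) ^+
    2).
Proof.
move=> [x1 x2]; rewrite !(hnorm2_sqr HX) /= (hnormB_sqr HI) (hnormD_sqr HI).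
rewrite !(hnormZ HI) !(ripZ HI) -(sa_sym S_sa)// [S x.1 ## _](ripC HI).
by rewrite !exprMn real_normK ?num_real//; ring.
Qed.

Lemma free_map_low h x : dom2 x -> N2 x <= N2 (free_map h x).
Proof.
move=> Dx; rewrite -(@ler_pXn2r _ 2)// ?nnegrE ?hnorm_ge0// free_map_norm//.
by rewrite lerDl mulr_ge0 ?addr_ge0 ?sqr_ge0.
Qed.

Lemma dom2_subr x y : dom2 x -> dom2 y -> dom2 (x - y).
Proof. by move=> Dx Dy; rewrite addrC -scaleN1r; exact: dom2_sub. Qed.

Lemma free_map_sub h x y : dom2 x -> dom2 y -> free_map h (x - y) = free_map h
  x - free_map h y.
Proof.
by move=> Dx Dy; rewrite addrC -scaleN1r free_map_lin// scaleN1r addrC.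
Qed.

Lemma free_map_inj h x y : dom2 x -> dom2 y -> free_map h x = free_map h y ->
  x = y.
Proof.
move=> Dx Dy e; have := free_map_low h (dom2_subr Dx Dy).
rewrite free_map_sub// e subrr (hnorm0 HI2) => le0.
apply/eqP; rewrite -subr_eq0; apply/eqP/(hnorm_eq0 HI2)/eqP.
by rewrite eq_le le0 hnorm_ge0.
Qed.

Lemma free_map_adj h x y : dom2 x -> dom2 y ->
  rip (ip2 ip) (free_map (- h) x) y = rip (ip2 ip) x (free_map h y).
Proof.
move=> [x1 x2] [y1 y2]; rewrite !rip2E /= (ripB HI) (ripD HI) !(ripZ HI).
rewrite ![(_ + _) ## _](ripC HI) !(ripD HI) !(ripN HI) !(ripZ HI).
rewrite [y.1 ## x.1](ripC HI) [y.2 ## x.2](ripC HI).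
rewrite -!(sa_sym S_sa)// [S x.2 ## y.1](ripC HI) [S x.1 ## y.2](ripC HI).
by rewrite -!(sa_sym S_sa)// [S y.1 ## x.2](ripC HI) [S y.2 ## x.1](ripC HI);
  ring.
Qed.

Lemma free_map_max h x y : h != 0 ->
  (forall w, dom2 w -> rip (ip2 ip) (free_map (- h) w) x = rip (ip2 ip) w y) ->
  dom2 x /\ free_map h x = y.
Proof.
move=> h0 wE; have D0 := sa_dom0 S_sa; have S0 := sa_map0 S_sa.
(* Test vectors [(0, w)] isolate [x.1] and test vectors [(w, 0)] isolate [x.2], so maximality of [S]
   applies to each component. *)
have [h1 h2] : DS x.1 /\ S x.1 = h^-1%:C%C *: (y.2 - x.2).
  apply: (sa_max HX S_sa) => w Dw; have := wE (0, w) (conj D0 Dw).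
  rewrite !rip2E /= S0 scaler0 addr0 add0r rmorphN scaleNr opprK.
  rewrite ![_ ## x.1](ripC HI) (ripZ HI) [0 ## _](ripC HI) (rip0 HI) add0r => e.
  by rewrite (ripZ HI) (ripB HI) -e; field.
have [h3 h4] : DS x.2 /\ S x.2 = h^-1%:C%C *: (x.1 - y.1).
  apply: (sa_max HX S_sa) => w Dw; have := wE (w, 0) (conj Dw D0).
  rewrite !rip2E /= S0 scaler0 subr0 add0r rmorphN scaleNr.
  rewrite ![_ ## x.2](ripC HI) (ripN HI) (ripZ HI) [0 ## _](ripC HI) (rip0 HI)
    addr0 => e.
  by rewrite (ripZ HI) (ripB HI) -e; field.
split=> //; rewrite /free_map h2 h4 !scalerA -rmorphM mulfV// rmorph1 !scale1r.
by rewrite subKr addrC subrK -surjective_pairing.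
Qed.

Lemma free_map_surj h y : h != 0 -> exists2 x, dom2 x & free_map h x = y.
Proof.
move=> h0; have D0 := sa_dom0 S_sa.
apply: (@adjoint_pair_surj _ _ _ H2 _ _ (free_map (- h)) 1) => //.
- by move=> r u v; exact: dom2_sub.
- by move=> r u v; exact: free_map_lin.
- by move=> u Du; rewrite mul1r; exact: free_map_low.
- by move=> u v; exact: free_map_adj.
- by move=> u v; exact: free_map_max.
(* A vector orthogonal to the range of [free_map h] is in the kernel of [free_map (- h)], which is
   bounded below. *)
move=> z z0; have [||Dz fz] := @free_map_max (- h) z 0;
  first by rewrite oppr_eq0.
  by move=> u Du; rewrite opprK z0// (rip0 HI2).
apply: (hnorm_eq0 HI2); apply/eqP; rewrite eq_le hnorm_ge0 andbT.
by apply: le_trans (free_map_low (- h) Dz) _; rewrite fz (hnorm0 HI2).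
Qed.

End FreeResolvent.

(** * The perturbation by B and C *)

Variables (B : X -> X) (a b : R).
Hypothesis HBlin : linear_on DS B.
Hypotheses (Ha0 : 0 <= a) (Ha1 : a < 1).
Hypothesis HBbd : forall x : X, DS x ->
  N (B x) ^+ 2 <= a ^+ 2 * N (S x) ^+ 2 + b ^+ 2 * N x ^+ 2.
Hypothesis HBsym_or_bdd :
  (forall x y : X, DS x -> DS y -> ip (B x) y = ip x (B y)) \/
  (exists M : R, forall x : X, DS x -> N (B x) <= M * N x).
Variables (C : X -> X) (c d : R).
Hypothesis HClin : linear_on DS C.
Hypothesis HCbd : forall x : X, DS x ->
  N (C x) ^+ 2 <= c ^+ 2 * N (S x) ^+ 2 + d ^+ 2 * N x ^+ 2.

Lemma B_bound x : DS x -> N (B x) <= a * N (S x) + `|b| * N x.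
Proof.
move=> Dx; have Sx0 := hnorm_ge0 ip (S x); have x0 := hnorm_ge0 ip x.
have p0 : 0 <= a * N (S x) by rewrite mulr_ge0.
have q0 : 0 <= `|b| * N x by rewrite mulr_ge0.
rewrite -(@ler_pXn2r _ 2)// ?nnegrE ?hnorm_ge0 ?addr_ge0//.
apply: le_trans (HBbd Dx) _.
rewrite sqrrD !exprMn real_normK ?num_real// -mulr_natr.
have := mulr_ge0 p0 q0; lra.
Qed.

(** For symmetric [B] the number [ip (B x) x] is real, so the real part of [ip x ('i *: B x)]
    vanishes; for bounded [B] Cauchy-Schwarz suffices. *)
Lemma B_numerical : exists2 M : R, 0 <= M &
  forall x, DS x -> `|x ## ('i%C *: B x)| <= M * N x ^+ 2.
Proof.
case: HBsym_or_bdd => [sym|[M HM]].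
  exists 0 => // x Dx; rewrite mul0r (ripC HI) (rip_i HI).
  have [cj _ _ _] := HI; have := sym x x Dx Dx; rewrite [ip x _]cj.
  by case: (ip (B x) x) => p q [] /= qE; rewrite normr_le0; apply/eqP; lra.
exists `|M| => // x Dx; apply: le_trans (rip_norm_le HI _ _) _.
rewrite (hnorm_i HI) expr2 mulrCA ler_wpM2l ?hnorm_ge0//.
by apply: le_trans (HM x Dx) _; rewrite ler_wpM2r ?hnorm_ge0// ler_norm.
Qed.

(** With [u = Sinv p], insert [S u = p] and [eps |u|^2 <= |p|^2] into the bound on [C u]. *)
Definition bound_CSinv : R := Num.sqrt (c ^+ 2 + d ^+ 2 / eps).

Lemma C_Sinv_bound p : DS p -> N (C (Sinv p)) <= bound_CSinv * N p.
Proof.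
move=> Dp; have q0 : 0 <= c ^+ 2 + d ^+ 2 / eps.
  by rewrite addr_ge0 ?sqr_ge0// divr_ge0 ?sqr_ge0// ltW.
rewrite -(@ler_pXn2r _ 2)// ?nnegrE ?hnorm_ge0 ?mulr_ge0 ?sqrtr_ge0
  ?hnorm_ge0//.
rewrite exprMn [bound_CSinv ^+ 2](sqr_sqrtr q0);
  apply: le_trans (HCbd (Sinv_dom p)) _.
have := sqrt_coercive (Sinv_domA Dp); rewrite SinvK mulrC -ler_pdivlMr//.
move=> /(ler_wpM2l (sqr_ge0 d)) h.
by rewrite mulrDl lerD2l (le_trans h)// mulrA mulrAC.
Qed.

Local Notation N2 := (hnorm (ip2 ip)).
Local Notation H2 := (ip2_hilbert HX).
Local Notation HI2 := (ip2_inner HX).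
Local Notation V2 := (realification H2).

Definition pert (x : X * X) : X := - ('i%C *: B x.2) - C (Sinv x.1).
Definition wave_op (x : X * X) : X * X := (S x.2, - S x.1 + pert x).

Lemma pert_lin (r : R[i]) x y : dom2 x -> dom2 y ->
  pert (r *: x + y) = r *: pert x + pert y.
Proof.
move=> [x1 x2] [y1 y2]; rewrite /pert /= Sinv_lin HBlin// HClin;
  try exact: Sinv_dom.
by rewrite !scalerDr !scalerN !scalerA [_ * r]mulrC !opprD addrACA.
Qed.

Lemma wave_op_lin (r : R[i]) x y : dom2 x -> dom2 y ->
  wave_op (r *: x + y) = r *: wave_op x + wave_op y.
Proof.
move=> Dx Dy; have [[x1 x2] [y1 y2]] := (Dx, Dy).
rewrite /wave_op pert_lin//= !(sa_lin S_sa)//; congr (_, _) => /=.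
by rewrite [in RHS]scalerDr scalerN opprD [LHS]addrACA.
Qed.

Lemma wave_op_numerical : exists2 w : R, 0 <= w &
  forall x, dom2 x -> `|rip (ip2 ip) x (wave_op x)| <= w * N2 x ^+ 2.
Proof.
have [M M0 HM] := B_numerical; have K0 : 0 <= bound_CSinv by exact: sqrtr_ge0.
exists (M + bound_CSinv); first by rewrite addr_ge0.
move=> x [x1 x2]; rewrite rip2E /= (ripD HI) (ripN HI) /pert (ripB HI) (ripN
  HI).
rewrite -(sa_sym S_sa x1 x2) [S x.1 ## _](ripC HI).
have -> (p q r : R) : p + (- p + (- q - r)) = - (q + r) by ring.
rewrite normrN; apply: le_trans (ler_normD _ _) _; rewrite mulrDl lerD//.
  apply: le_trans (HM _ x2) _; rewrite ler_wpM2l// (hnorm2_sqr HX).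
  by rewrite lerDr sqr_ge0.
apply: le_trans (rip_norm_le HI _ _) _.
apply: (@le_trans _ _ (N2 x * (bound_CSinv * N2 x)));
  last by rewrite expr2 mulrCA.
apply: ler_pM; rewrite ?hnorm_ge0 ?(hnorm2_ge2 HX)//.
apply: le_trans (C_Sinv_bound x1) _; rewrite ler_wpM2l// (hnorm2_ge1 HX)//.
Qed.

(** Cauchy-Schwarz for [x] and [x - h G x], divided by [|x|]. The two-sided bound on the numerical
    range admits both signs of [h], hence a group and not only a semigroup. *)
Lemma wave_op_low (w : R) :
  (forall x, dom2 x -> `|rip (ip2 ip) x (wave_op x)| <= w * N2 x ^+ 2) ->
  forall (h : R) x, dom2 x ->
    (1 - w * `|h|) * N2 x <= N2 (x - h%:C%C *: wave_op x).
Proof.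
move=> Hw h x Dx; have [->|x0] := eqVneq (N2 x) 0.
  by rewrite mulr0 hnorm_ge0.
have xp : 0 < N2 x by rewrite lt_def x0 hnorm_ge0.
rewrite -(ler_pM2l xp); apply: le_trans (rip_le HI2 _ _).
rewrite (ripB HI2) (ripZ HI2) -(hnorm_sqr HI2).
have : h * rip (ip2 ip) x (wave_op x) <= `|h| * (w * N2 x ^+ 2).
  apply: le_trans (ler_norm _) _; rewrite normrM ler_wpM2l//; exact: Hw.
rewrite expr2; lra.
Qed.

(** With [z = free_map h x] the equation reads [z - L z = y]. In the norm of [L], [B] relative to
    [S] contributes [a], and the choice of [h0] keeps the rest below [(1 - a) / 2], which gives the
    contraction factor [(1 + a) / 2]. *)
Lemma wave_op_surj : exists2 h0 : R, 0 < h0 & forall (h : R) y,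
  0 < `|h| < h0 -> exists2 x, dom2 x & x - h%:C%C *: wave_op x = y.
Proof.
have K0 : 0 <= bound_CSinv by exact: sqrtr_ge0.
have q0 : 0 < `|b| + bound_CSinv + 1 by rewrite ltr_wpDl// addr_ge0.
have k01 : 0 <= (1 + a) / 2 < 1.
  by have := Ha0; have := Ha1 => *; apply/andP; split; lra.
exists ((1 - a) / 2 / (`|b| + bound_CSinv + 1)).
  by rewrite !divr_gt0// subr_gt0.
move=> h y /andP[]; rewrite normr_gt0 => hn0; rewrite ltr_pdivlMr// => hh.
have /choice[J HJ] : forall z, exists x, dom2 x /\ free_map h x = z.
  by move=> z; have [x Dx xz] := free_map_surj z hn0; exists x.
have JD z : dom2 (J z) by have [] := HJ z.
have JE z : free_map h (J z) = z by have [] := HJ z.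
pose L (z : V2) : V2 := (0, h%:C%C *: pert (J z)).
have JB z z' : J (z - z') = J z - J z'.
  by apply: (@free_map_inj h) => //;
    [exact: dom2_subr|rewrite free_map_sub// !JE].
have LB (z z' : V2) : L (z - z') = L z - L z'.
  rewrite /L JB (_ : J z - J z' = -1 *: J z' + J z); last first.
    by rewrite scaleN1r addrC.
  rewrite pert_lin// scaleN1r [- _ + _]addrC scalerBr.
  by congr (_, _); rewrite /= subr0.
have Lk (z : V2) : `|L z| <= (1 + a) / 2 * `|z|.
  change (N2 (L z) <= (1 + a) / 2 * N2 z).
  have [x1 x2] := JD z.
  have := hnorm2_le HX (L z); rewrite /= (hnorm0 HI).
  rewrite add0r (hnormZ HI) => /le_trans; apply.
  have nz := hnorm_ge0 (ip2 ip) z.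
  have n1 : N (J z).1 <= N2 z.
    by rewrite -{2}(JE z);
      apply: le_trans (hnorm2_ge1 HX _) (free_map_low h (JD z)).
  have n2 : N (J z).2 <= N2 z.
    by rewrite -{2}(JE z);
      apply: le_trans (hnorm2_ge2 HX _) (free_map_low h (JD z)).
  (* One summand of the identity [free_map_norm]. *)
  have n3 : `|h| * N (S (J z).2) <= N2 z.
    rewrite -(@ler_pXn2r _ 2)// ?nnegrE ?mulr_ge0 ?hnorm_ge0//.
    rewrite exprMn real_normK ?num_real// -[leRHS](congr1 (fun x => N2 x ^+ 2)
      (JE z)).
    rewrite free_map_norm// mulrDr.
    have := sqr_ge0 (N2 (J z)).
    have := mulr_ge0 (sqr_ge0 h) (sqr_ge0 (N (S (J z).1))); lra.
  have n4 : N (pert (J z)) <= a * N (S (J z).2) + `|b| * N (J z).2 +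
    bound_CSinv * N (J z).1.
    apply: le_trans (hnormD HI _ _) _; rewrite !(hnormN HI) (hnorm_i HI).
    by rewrite lerD ?B_bound ?C_Sinv_bound.
  have h0 := normr_ge0 h; apply: le_trans (ler_wpM2l h0 n4) _.
  have m3 := ler_wpM2l Ha0 n3.
  have m2 := ler_wpM2l (mulr_ge0 h0 (normr_ge0 b)) n2.
  have m1 := ler_wpM2l (mulr_ge0 h0 K0) n1.
  have m4 := ler_wpM2r nz (ltW hh); have m5 := mulr_ge0 h0 nz.
  lra.
have [z zE] := neumann_surj k01 LB Lk y.
exists (J z) => //; have -> : y = free_map h (J z) - (0, h%:C%C *: pert (J z)).
  by rewrite JE -zE.
congr (_, _) => /=; first by rewrite subr0.
by rewrite scalerDr scalerN opprD opprK addrA.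
Qed.

Lemma dom2_dense x (e : R) : 0 < e -> exists2 y, dom2 y & N2 (x - y) < e.
Proof.
move=> e0; have [_ _ dn _] := S_sa; have e2 : 0 < e / 2 by rewrite divr_gt0.
have [y1 [D1 h1]] := dn x.1 _ e2; have [y2 [D2 h2]] := dn x.2 _ e2.
exists (y1, y2) => //; apply: le_lt_trans (hnorm2_le HX _) _.
by move: h1 h2 => /=; lra.
Qed.

Lemma wave_generator : exists w h0 : R, [/\ 0 <= w, 0 < h0, w * h0 <= 1 / 2,
  (forall (h : R) (x : V2), dom2 x ->
     (1 - w * `|h|) * `|x| <= `|x - h *: (wave_op x : V2)|) &
  (forall (h : R) (y : V2), 0 < `|h| < h0 ->
     exists2 x : V2, dom2 x & x - h *: (wave_op x : V2) = y)].
Proof.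
have [w w0 Hw] := wave_op_numerical; have [h1 h10 Hs] := wave_op_surj.
have w1 : 0 < w + 1 by rewrite ltr_wpDl.
have q0 : 0 < 1 / 2 / (w + 1) :> R by rewrite !divr_gt0.
exists w, (Num.min h1 (1 / 2 / (w + 1))); split => //.
- by rewrite lt_min h10.
- apply: (@le_trans _ _ (w * (1 / 2 / (w + 1)))).
    by rewrite ler_wpM2l// ge_min lexx orbT.
  rewrite mulrA ler_pdivrMr//; lra.
- exact: wave_op_low Hw.
- move=> h y; rewrite lt_min => /and3P[n0 n1 _]; apply: Hs.
  by rewrite n0.
Qed.

Lemma wave_solution t0 (x : V2) : dom2 x -> exists u : R -> V2,
  u t0 = x /\ forall t, dom2 (u t) /\ has_derivative u t (wave_op (u t)).
Proof.
have [w [h0 [w0 h00 wh low su]]] := wave_generator.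
apply: (generator_solution _ _ _ w0 h00 wh low su).
- by move=> r y z; exact: dom2_sub.
- by move=> r y z; exact: wave_op_lin.
- exact: dom2_dense.
Qed.

Lemma wave_unique t0 (u v : R -> V2) :
  (forall t, dom2 (u t) /\ has_derivative u t (wave_op (u t))) ->
  (forall t, dom2 (v t) /\ has_derivative v t (wave_op (v t))) ->
  u t0 = v t0 -> forall t, u t = v t.
Proof.
have [w [h0 [w0 h00 wh low su]]] := wave_generator.
apply: (generator_unique _ _ _ w0 h00 wh low su).
- by move=> r y z; exact: dom2_sub.
- by move=> r y z; exact: wave_op_lin.
- exact: dom2_dense.
Qed.

(** * From the first-order system back to the second-order equation *)

Lemma has_deriv_NP (u : R -> X) t v : has_deriv_N N u t v <->
  forall e : R, 0 < e -> exists2 r : R, 0 < r & forall h : R, `|h| < r ->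
    N (u (t + h) - u t - h%:C%C *: v) <= e * `|h|.
Proof.
have quot h : h != 0 -> N (u (t + h) - u t - h%:C%C *: v) =
    `|h| * N ((h^-1)%:C%C *: (u (t + h) - u t) - v).
  move=> hn0; rewrite -(hnormZ HI) scalerBr scalerA -rmorphM mulfV//.
  by rewrite rmorph1 scale1r.
split=> du e e0.
  have [r [r0 Hr]] := du e e0; exists r => // h hr.
  have [->|hn0] := eqVneq h 0.
    by rewrite addr0 subrr rmorph0 scale0r subr0 (hnorm0 HI) normr0 mulr0.
  by rewrite quot// mulrC ler_wpM2r// Hr.
have [r r0 Hr] := du e e0; exists r; split => // h hn0 /Hr.
by rewrite quot// mulrC ler_pM2r// normr_gt0.
Qed.

Lemma has_derivative_pair (u : R -> V2) t (v : V2) : has_derivative u t v <->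
  has_deriv_N N (fun s => (u s).1) t v.1 /\
  has_deriv_N N (fun s => (u s).2) t v.2.
Proof.
split=> [du|[/has_deriv_NP d1 /has_deriv_NP d2] e e0].
  split; apply/has_deriv_NP => e /du[r r0 Hr]; exists r => // h /Hr;
    apply: le_trans.
    exact: (hnorm2_ge1 HX (u (t + h) - u t - h%:C%C *: v)).
  exact: (hnorm2_ge2 HX (u (t + h) - u t - h%:C%C *: v)).
have e2 : 0 < e / 2 by rewrite divr_gt0.
have [r1 r10 Hr1] := d1 _ e2; have [r2 r20 Hr2] := d2 _ e2.
exists (Num.min r1 r2); first by rewrite lt_min r10.
move=> h; rewrite lt_min => /andP[/Hr1 h1 /Hr2 h2].
change (N2 (u (t + h) - u t - h%:C%C *: v) <= e * `|h|).
apply: le_trans (hnorm2_le HX _) _; move: h1 h2 => /=; lra.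
Qed.

(** [S] is a linear isometry from [W_1] to [X], so it carries difference quotients to difference
    quotients without loss. *)
Lemma has_deriv_S (u : R -> X) t v : (forall s, DS (u s)) -> DS v ->
  has_deriv_N (fun x => N (S x)) u t v <-> has_deriv_N N (S \o u) t (S v).
Proof.
move=> Du Dv.
have SE h : S ((h^-1)%:C%C *: (u (t + h) - u t) - v) =
    (h^-1)%:C%C *: ((S \o u) (t + h) - (S \o u) t) - S v.
  have [D1 S1] := sa_subr S_sa (Du (t + h)) (Du t).
  have [D2 S2] := sa_scale S_sa (h^-1)%:C%C D1.
  by have [_ ->] := sa_subr S_sa D2 Dv; rewrite S2 S1.
by split=> du e /du[r [r0 Hr]]; exists r; split => // h hn0 /(Hr _ hn0);
  rewrite SE.
Qed.

(* A solution [u] corresponds to the curve [(S u, u')] of the first-order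
   equation; since [S] is onto, this is an equivalence. *)
Lemma is_solutionP t0 xi eta u : DA xi ->
  is_solution ip DA A DS S B C t0 xi eta u <->
  exists x : R -> V2, [/\ x t0 = (S xi, eta),
    (forall t, dom2 (x t) /\ has_derivative x t (wave_op (x t))) &
    forall t, u t = Sinv (x t).1].
Proof.
move=> Hxi; split.
  move=> [Du [u' [u'' [d1 d2 u0 u'0 eq]]]].
  exists (fun t => (S (u t), u' t)); split.
  - by rewrite u0 u'0.
  - move=> t; have [Du' du] := d1 t; have [DAu eqt] := eq t.
    have /domA[_ DSu] := DAu; split => //; apply/has_derivative_pair => /=.
    split; first exact/has_deriv_S.
    suff -> : - S (S (u t)) + pert (S (u t), u' t) = u'' t by [].
    rewrite /pert /= SinvE// sqrt_sqrt//; apply/eqP.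
    rewrite eq_sym -subr_eq0 -eqt; apply/eqP.
    by rewrite !opprD !opprK -[RHS]addrA; congr (_ + _); exact: addrCA.
  - by move=> t /=; rewrite SinvE.
move=> [x [x0 dx uE]].
have Du t : DS (u t) by rewrite uE; exact: Sinv_dom.
have Su t : S (u t) = (x t).1 by rewrite uE SinvK.
split=> //; exists (fun t => (x t).2), (fun t => (wave_op (x t)).2); split.
- move=> t; have [[D1 D2] /has_derivative_pair[e1 e2]] := dx t; split => //.
  apply/has_deriv_S => //.
  by rewrite (_ : S \o u = fun s => (x s).1)//; apply/funext.
- by move=> t; have [_ /has_derivative_pair[]] := dx t.
- by rewrite uE x0 SinvE//; have /domA[] := Hxi.
- by rewrite x0.
- move=> t; have [[D1 D2] _] := dx t.
  have DAu : DA (u t) by rewrite uE; exact: Sinv_domA.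
  split => //; rewrite /wave_op /pert /= -sqrt_sqrt// Su -uE.
  by rewrite (addrA (- S _)) (addrAC _ (- C _)) subrK -opprD addNr.
Qed.
End WaveOperator.

Theorem theorem11
  (R : realType) (X : lmodType R[i]) (ip : X -> X -> R[i])
  (HX : is_hilbert ip) (Hnontriv : exists x : X, x != 0)
  (DA : X -> Prop) (A : X -> X) (HA : self_adjoint ip DA A)
  (eps : R) (Heps : 0 < eps)
  (HAcoer : forall x : X, DA x -> (eps%:C)%C * ip x x <= ip x (A x))
  (DS : X -> Prop) (S : X -> X) (HS : is_pos_sqrt ip DA A DS S)
  (B : X -> X) (HBlin : linear_on DS B) (a b : R)
  (Ha0 : 0 <= a) (Ha1 : a < 1)
  (HBbd : forall x : X, DS x ->
     hnorm ip (B x) ^+ 2 <= a ^+ 2 * hnorm ip (S x) ^+ 2 + b ^+ 2 * hnorm ip x ^+ 2)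
  (HBsym_or_bdd :
     (forall x y : X, DS x -> DS y -> ip (B x) y = ip x (B y)) \/
     (exists M : R, forall x : X, DS x -> hnorm ip (B x) <= M * hnorm ip x))
  (C : X -> X) (HClin : linear_on DS C) (c d : R)
  (HCbd : forall x : X, DS x ->
     hnorm ip (C x) ^+ 2 <= c ^+ 2 * hnorm ip (S x) ^+ 2 + d ^+ 2 * hnorm ip x ^+ 2)
  (t0 : R) (xi eta : X) (Hxi : DA xi) (Heta : DS eta) :
  exists u : R -> X,
    is_solution ip DA A DS S B C t0 xi eta u /\
    (forall v : R -> X, is_solution ip DA A DS S B C t0 xi eta v -> v = u).
Proof.
have solE := is_solutionP HX HA Heps HAcoer HS B C t0 eta _ Hxi.
have [DSxi DSSxi] := (domA HS xi).1 Hxi.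
have [|x [x0 dx]] := wave_solution (HX := HX) HA Heps HAcoer HS HBlin Ha0 Ha1 HBbd
  HBsym_or_bdd HClin HCbd t0 (x := (S xi, eta)) _; first by split.
exists (fun t => Sinv DS S (x t).1); split; first by apply/solE; exists x.
move=> v /solE[y [y0 dy vE]]; apply/funext => t; rewrite vE.
by rewrite (wave_unique HA Heps HAcoer HS HBlin Ha0 Ha1 HBbd HBsym_or_bdd HClin
  HCbd dy dx (etrans y0 (esym x0))).
Qed.
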